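(* Let $(\Omega,\mathcal{F},\mathbb{P})$ be a complete probability space, $t_0<T$, $x_0$ a random variable and $a$ a stochastic process on $[t_0,T]$, and let $x(t,\omega)=x_0(\omega)\mathrm{e}^{\int_{t_0}^t a(s,\omega)\mathrm{d} s}$. Assume: (H1) $a\in \mathrm{L}^2([t_0,T]\times\Omega)$; (H2) for every $N\ge2$, $x_0$, $\xi_1$ and $(\xi_2,\ldots,\xi_N)$ are absolutely continuous and independent; (H3) the density $f_{\xi_1}$ of $\xi_1$ is continuous and bounded on $\mathbb{R}$; (H4) $\int_{t_0}^t\phi_1(s)\,\mathrm{d} s\ne0$ for all $t\in(t_0,T]$; (H5) either $x_0>0$ a.s. or $x_0<0$ a.s. Then for each fixed $t\in(t_0,T]$ and $x\ne0$, the sequence \[ f_1^N(x,t)=\int_{\mathbb{R}^N} f_0\big(x\,\mathrm{e}^{-K_a(t,\pmb{\xi}_N)}\big)f_{\pmb{\xi}_N}(\pmb{\xi}_N)\,\mathrm{e}^{-K_a(t,\pmb{\xi}_N)}\,\mathrm{d}\pmb{\xi}_N \] (where $f_0$ is the density of $x_0$) converges to $f_1(x,t)$, where $f_1(\cdot,t)$ is a probability density of $x(t,\cdot)$.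
   Context: Karhunen–Loève expansion: for $a\in \mathrm{L}^2([t_0,T]\times\Omega)$ write $a(t,\omega)=\mu_a(t)+\sum_{j=1}^\infty\sqrt{\nu_j}\,\phi_j(t)\xi_j(\omega)$ (convergence in $\mathrm{L}^2([t_0,T]\times\Omega)$), where $\mu_a(t)=\mathbb{E}[a(t)]$, $\{(\nu_j,\phi_j)\}$ are the (nonnegative) eigenvalue/eigenfunction pairs of the covariance operator $\mathcal{C}f(t)=\int_{t_0}^T\mathrm{Cov}[a(t),a(s)]f(s)\,\mathrm{d} s$ on $\mathrm{L}^2([t_0,T])$ with $\{\phi_j\}$ an orthonormal basis, and $\xi_j$ are zero-mean, unit-variance, pairwise uncorrelated random variables; pairs may be enumerated in any order (here $\nu_1>0$). $\pmb{\xi}_N=(\xi_1,\ldots,\xi_N)$, $f_{\pmb{\xi}_N}$ its density, $K_a(t,\pmb{\xi}_N)=\int_{t_0}^t\big(\mu_a(s)+\sum_{j=1}^N\sqrt{\nu_j}\phi_j(s)\xi_j\big)\mathrm{d} s$. *)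

(* Defs.v *)
From HB Require Import structures.
From mathcomp Require Import all_boot all_order all_algebra.
From mathcomp Require Import all_classical all_reals all_analysis.
Set Implicit Arguments.
Unset Strict Implicit.
Unset Printing Implicit Defensive.
Import Order.TTheory GRing.Theory Num.Theory.
Import numFieldNormedType.Exports.
Local Open Scope classical_set_scope.
Local Open Scope ring_scope.

Section Defs.
Context {R : realType}.
Local Notation leb := (@lebesgue_measure R).

Definition intI (a b : R) (f : R -> R) : R :=
  fine (\int[leb]_(s in `[a, b]) (f s)%:E)%E.

(* Iterated Lebesgue integral over R^N (tuples), i.e.
   int dv_1 int dv_2 ... int dv_N g(v_1,...,v_N); for the nonnegative
   measurable integrands used below this is (Tonelli) the integral with
   respect to N-dimensional Lebesgue measure. *)
Fixpoint iint (N : nat) : (N.-tuple R -> \bar R) -> \bar R :=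
  match N with
  | 0 => fun g => g [tuple]
  | n.+1 => fun g =>
      (\int[leb]_(y in [set: R]) iint (fun v : n.-tuple R => g (cons_tuple y v)))%E
  end.

Definition is_density d (T : measurableType d) (P : probability T R)
    (X : T -> R) (f : R -> R) : Prop :=
  [/\ (forall x, 0 <= f x), measurable_fun [set: R] f &
      forall A : set R, measurable A ->
        P (X @^-1` A) = (\int[leb]_(x in A) (f x)%:E)%E].

Definition is_density_vec d (T : measurableType d) (P : probability T R)
    (N : nat) (X : T -> N.-tuple R) (f : N.-tuple R -> R) : Prop :=
  [/\ (forall v, 0 <= f v), measurable_fun [set: N.-tuple R] f &
      forall A : set (N.-tuple R), measurable A ->
        P (X @^-1` A) = iint (fun v => (f v)%:E * (\1_A v)%:E)%E].

Definition abs_cont d (T : measurableType d) (P : probability T R) (X : T -> R) :=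
  exists f, is_density P X f.

Definition abs_cont_vec d (T : measurableType d) (P : probability T R) N
    (X : T -> N.-tuple R) := exists f, is_density_vec P X f.

Definition indep3 d (T : measurableType d) (P : probability T R)
    d1 d2 d3 (T1 : measurableType d1) (T2 : measurableType d2)
    (T3 : measurableType d3) (X : T -> T1) (Y : T -> T2) (Z : T -> T3) :=
  forall A B C, measurable A -> measurable B -> measurable C ->
    P (X @^-1` A `&` Y @^-1` B `&` Z @^-1` C) =
    (P (X @^-1` A) * P (Y @^-1` B) * P (Z @^-1` C))%E.

Definition mean_fun d (T : measurableType d) (P : probability T R)
    (a : R -> T -> R) (t : R) : R := fine (\int[P]_w (a t w)%:E)%E.

Definition cov_fun d (T : measurableType d) (P : probability T R)
    (a : R -> T -> R) (t s : R) : R :=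
  fine (\int[P]_w ((a t w - mean_fun P a t) * (a s w - mean_fun P a s))%:E)%E.

(* The random vector xi_N = (xi_1, ..., xi_N) (xi indexed from 1). *)
Definition xi_vec d (T : measurableType d) (xi : nat -> T -> R) (N : nat)
    (w : T) : N.-tuple R := [tuple xi i.+1 w | i < N].

Definition xi_tail d (T : measurableType d) (xi : nat -> T -> R) (N : nat)
    (w : T) : N.-1.-tuple R := [tuple xi i.+2 w | i < N.-1].

Definition K_a (mu : R -> R) (nu : nat -> R) (phi : nat -> R -> R) (t0 t : R)
    (N : nat) (v : N.-tuple R) : R :=
  intI t0 t (fun s => mu s + \sum_(i < N) Num.sqrt (nu i.+1) * phi i.+1 s * tnth v i).

Definition f1N (f0 : R -> R) (mu : R -> R) (nu : nat -> R) (phi : nat -> R -> R)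
    (t0 : R) (fxi : forall N : nat, N.-tuple R -> R) (N : nat) (x t : R) : \bar R :=
  iint (fun v : N.-tuple R =>
    (f0 (x * expR (- K_a mu nu phi t0 t v)) * fxi N v
      * expR (- K_a mu nu phi t0 t v))%:E).

End Defs.

(* Main.v *)
Require Import Defs.
From HB Require Import structures.
From mathcomp Require Import all_boot all_order all_algebra.
From mathcomp Require Import all_classical all_reals all_analysis.
From mathcomp Require Import measurable_realfun ring lra.
Set Implicit Arguments.
Unset Strict Implicit.
Unset Printing Implicit Defensive.
Import Order.TTheory GRing.Theory Num.Theory.
Import numFieldNormedType.Exports.
Local Open Scope classical_set_scope.
Local Open Scope ring_scope.

(** Put [c_j = sqrt nu_j * \int_(t0)^t phi_j], let [m] be the integral of the mean,
    [K_N = m + \sum_(j <= N) c_j xi_j] and [K = \int_(t0)^t a(s) ds].  Convergence of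
    the Karhunen-Loeve expansion in L^2 gives [E |K_N - K| -> 0], and independence
    survives such limits: with [S_N = K_N - m - c_1 xi_1] and [S = K - m - c_1 xi_1],
    [xi_1] is independent of [S_N], hence of [S], and likewise [x_0] of [K_N], hence
    of [K].  As [c_1 <> 0], [K_N] and [K] have the densities
    [k_N u = E [f_xi1 ((u - m - S_N) / c_1)] / |c_1|] and
    [k u = E [f_xi1 ((u - m - S) / c_1)] / |c_1|], which are uniformly bounded, and
    [k_N u -> k u] because [f_xi1] is continuous and bounded.  Now
    [f_1^N(x) = E [f_0 (x e^(-K_N)) e^(-K_N)] = \int f_0 (x e^(-u)) e^(-u) k_N u du], and
    [u |-> f_0 (x e^(-u)) e^(-u)] is integrable for [x <> 0]; by dominated convergence
    the limit is the same integral with [k] in place of [k_N], which is the density of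
    [x_0 e^K]. *)

(** * Expectations computed from a density *)

Section density.
Local Open Scope ereal_scope.
Context d d' (T : measurableType d) (T' : measurableType d') (R : realType).
Variables (P : {measure set T -> \bar R}) (mu : {measure set T' -> \bar R}).
Variables (X : T -> T') (mX : measurable_fun [set: T] X).
Variables (f : T' -> R) (f_ge0 : forall x, (0 <= f x)%R).
Hypothesis mf : measurable_fun [set: T'] f.
Hypothesis Xf : forall A, measurable A ->
  P (X @^-1` A) = \int[mu]_(x in A) (f x)%:E.

Import HBNNSimple.

(** The hypothesis [Xf] is the case where [g] is an indicator. Linearity extends it to simple
    functions, and monotone convergence along [nnsfun_approx], on both sides, to every nonnegative
    measurable [g]. *)
Lemma ge0_integral_density (g : T' -> \bar R) :
  measurable_fun [set: T'] g -> (forall x, 0 <= g x) ->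
  \int[P]_w g (X w) = \int[mu]_x (g x * (f x)%:E).
Proof.
move=> mg g0.
pose g_ := nnsfun_approx measurableT mg.
have cvg_g x : (g_ n x)%:E @[n --> \oo] --> g x by exact: cvg_nnsfun_approx.
have mgf n : measurable_fun setT (fun x => (g_ n x * f x)%:E).
  by apply/measurable_EFinP/measurable_funM.
transitivity (limn (fun n => \int[P]_w (g_ n (X w))%:E)).
  rewrite -monotone_convergence//.
  - by apply: eq_integral => w _; apply/esym/cvg_lim => //; exact: cvg_g.
  - by move=> n; apply/measurable_EFinP; exact: measurableT_comp.
  - by move=> n w _; rewrite lee_fin.
  - by move=> w _ m n mn; rewrite lee_fin; exact/lefP/nd_nnsfun_approx.
transitivity (limn (fun n => \int[mu]_x (g_ n x * f x)%:E)); last first.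
  rewrite -monotone_convergence//.
  - apply: eq_integral => x _; apply/cvg_lim => //.
    under eq_cvg do rewrite EFinM.
    by apply: cvgeZr => //; exact: cvg_g.
  - by move=> n x _; rewrite lee_fin mulr_ge0.
  - move=> x _ m n mn; rewrite lee_fin ler_wpM2r//.
    by exact/lefP/nd_nnsfun_approx.
(* It remains to treat each simple function: split it over its finitely many values, so that [Xf]
   applies to every level set. *)
congr (limn _); apply/funext => n.
transitivity (\sum_(k \in range (g_ n))
    \int[P]_w (k * \1_(X @^-1` (g_ n @^-1` [set k])) w)%:E).
  under eq_integral do rewrite fimfunE -fsumEFin//.
  rewrite ge0_integral_fsum//; last first.
    by move=> y x _; rewrite nnfun_muleindic_ge0.
  move=> y; apply/measurable_EFinP/measurable_funM => //.
  exact: measurableT_comp.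
transitivity (\sum_(k \in range (g_ n))
    \int[mu]_x (k * \1_(g_ n @^-1` [set k]) x * f x)%:E); last first.
  rewrite -ge0_integral_fsum//.
  - apply: eq_integral => x _; rewrite fsumEFin//; congr EFin.
    by rewrite [in RHS]fimfunE mulr_fsuml.
  - by move=> r; apply/measurable_EFinP; do 2 apply: measurable_funM => //.
  - move=> r x _; rewrite EFinM mule_ge0 ?lee_fin//.
    by rewrite -lee_fin nnfun_muleindic_ge0.
apply: eq_fsbigr => r /set_mem [x0 _ <-].
set r0 := g_ n x0.
have mA : measurable (g_ n @^-1` [set r0]) by exact: measurable_sfunP.
under eq_integral do rewrite EFinM.
rewrite ge0_integralZl//; last 2 first.
- apply/measurable_EFinP; apply: measurable_indic.
  by rewrite -[X in measurable X]setTI; exact: mX.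
- by rewrite lee_fin.
rewrite integral_indic// ?setIT; last by rewrite -[X in measurable X]setTI; exact: mX.
rewrite Xf//.
under [RHS]eq_integral do rewrite -mulrA EFinM.
rewrite ge0_integralZl//; last 3 first.
- by apply/measurable_EFinP; apply: measurable_funM.
- by move=> x _; rewrite lee_fin mulr_ge0.
- by rewrite lee_fin.
congr (_ * _).
rewrite [LHS]integral_mkcond; apply: eq_integral => x _.
by rewrite epatch_indic muleC.
Qed.

End density.

(** * Tonelli's theorem for two independent variables *)

Section independent_pair.
Local Open Scope ereal_scope.
Context d d1 d2 (T : measurableType d) (T1 : measurableType d1)
  (T2 : measurableType d2) (R : realType).
Variables (P : probability T R) (X : T -> T1) (Y : T -> T2).
Hypotheses (mX : measurable_fun [set: T] X) (mY : measurable_fun [set: T] Y).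

Definition indep2 := forall A B, measurable A -> measurable B ->
  P (X @^-1` A `&` Y @^-1` B) = P (X @^-1` A) * P (Y @^-1` B).

Hypothesis XY : indep2.

(** By independence the joint law agrees with the product of the marginal laws on rectangles, hence
    everywhere, and Tonelli applies to the product. Both integrals are pulled back to [P], so that
    no law appears in the statement. *)
Lemma ge0_integral_indep2 (F : T1 * T2 -> \bar R) :
  measurable_fun setT F -> (forall z, 0 <= F z) ->
  \int[P]_w F (X w, Y w) = \int[P]_w \int[P]_w' F (X w, Y w').
Proof.
move=> mF F0.
pose X' : {mfun T >-> T1} := HB.pack X (isMeasurableFun.Build _ _ _ _ _ mX).
pose Y' : {mfun T >-> T2} := HB.pack Y (isMeasurableFun.Build _ _ _ _ _ mY).
have mXY : measurable_fun setT (fun w => (X w, Y w)) by exact: measurable_fun_pair.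
pose XY' : {mfun T >-> (T1 * T2)%type} :=
  HB.pack (fun w => (X w, Y w)) (isMeasurableFun.Build _ _ _ _ _ mXY).
pose DX : probability T1 R := distribution P X'.
pose DY : probability T2 R := distribution P Y'.
pose DXY : probability (T1 * T2)%type R := distribution P XY'.
have DE : forall A, measurable A -> (DX \x DY) A = DXY A.
  apply: product_measure_unique => A B mA mB.
  by rewrite /DX /DY /DXY /= /distribution /pushforward/= -XY.
transitivity (\int[DXY]_z F z).
  by rewrite ge0_integral_distribution.
transitivity (\int[DX \x DY]_z F z).
  by apply: eq_measure_integral => A mA _; exact/esym/DE.
rewrite fubini_tonelli1// /fubini_F.
rewrite ge0_integral_distribution//=; last 2 first.
- exact: measurable_fun_fubini_tonelli_F.
- by move=> x; exact: integral_ge0.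
apply: eq_integral => w _; rewrite ge0_integral_distribution//.
exact: measurableT_comp.
Qed.

End independent_pair.

(** Carries the measurability of [f] as an argument, so that the image is a bundled measure to which
    uniqueness theorems apply. *)
Definition image_measure d d' (T1 : measurableType d) (T2 : measurableType d')
    (R : realFieldType) (m : {measure set T1 -> \bar R}) (f : T1 -> T2)
    (mf : measurable_fun [set: T1] f) : {measure set T2 -> \bar R}.
Proof. by refine (pushforward m f). Defined.
Arguments image_measure {d d' T1 T2 R} m {f} mf.

(** * Affine change of variables for Lebesgue measure *)

Section affine.
Context {R : realType}.
Local Notation mu := (@lebesgue_measure R).

Let aff (b c : R) : R -> R := fun y => b + c * y.

Let measurable_aff b c : measurable_fun [set: R] (aff b c).
Proof. by apply: measurable_funD => //; exact: measurable_funM. Qed.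

(** Lebesgue measure is determined by its values on half-open intervals, and [|c|] times the image
    measure has the same values there. *)
Lemma lebesgue_measure_affine (b c : R) (A : set R) : c != 0 -> measurable A ->
  mu (aff b c @^-1` A) = (`|c|^-1%:E * mu A)%E.
Proof.
move=> c0 mA.
have c_gt0 : 0 < `|c| by rewrite normr_gt0.
have c_ge0 : 0 <= `|c| by exact: ltW.
have mX : @measurable_fun _ _ (measurableTypeR R) (measurableTypeR R) setT
  (aff b c) := measurable_aff b c.
pose m : {measure set (measurableTypeR R) -> \bar R} :=
  mscale (NngNum c_ge0) (image_measure mu mX).
have -> : mu A = m A.
  apply: lebesgue_measure_unique => // _ [[u v]] _ <- /=.
  rewrite /m /= /mscale/= /pushforward/=.
  have [|] := ltP u v => uv; last first.
    rewrite !set_itv_ge ?preimage_set0 ?measure0 ?mule0// bnd_simp -leNgt//.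
  (* A negative [c] reverses the interval, so its preimage is closed on the left instead of on the
     right; the length is [(v - u) / |c|] in both cases. *)
  have [cn|cp] := ltP c 0.
    rewrite (_ : _ @^-1` _ = `[(v - b) / c, (u - b) / c[%classic); last first.
      apply/seteqP; split => y /=; rewrite /aff !in_itv/=.
        by rewrite ler_ndivrMr// ltr_ndivlMr// !lerBrDl !ltrBlDl mulrC => /andP[-> ->].
      by rewrite ler_ndivrMr// ltr_ndivlMr// !lerBrDl !ltrBlDl mulrC => /andP[-> ->].
    rewrite !lebesgue_measure_itv/= !lte_fin uv ltr_nM2r ?invr_lt0// ltrD2r uv.
    rewrite -!EFinB -EFinM; congr EFin; rewrite ltr0_norm//; field; rewrite lt_eqF//.
  have {}cp : 0 < c by rewrite lt_neqAle eq_sym c0.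
  rewrite (_ : _ @^-1` _ = `](u - b) / c, (v - b) / c]%classic); last first.
    apply/seteqP; split => y /=; rewrite /aff !in_itv/=.
      by rewrite ltr_pdivrMr// ler_pdivlMr// !ltrBlDl !lerBrDl mulrC => /andP[-> ->].
    by rewrite ltr_pdivrMr// ler_pdivlMr// !ltrBlDl !lerBrDl mulrC => /andP[-> ->].
  rewrite !lebesgue_measure_itv/= !lte_fin uv ltr_pM2r ?invr_gt0// ltrD2r uv.
  rewrite -!EFinB -EFinM; congr EFin; rewrite gtr0_norm//; field; rewrite gt_eqF//.
rewrite /m /= /mscale/= /pushforward/= muleA -EFinM mulVf ?mul1e//.
by rewrite gt_eqF.
Qed.

Lemma ge0_integral_affine (b c : R) (f : R -> \bar R) : c != 0 ->
  measurable_fun [set: R] f -> (forall x, 0 <= f x)%E ->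
  (\int[mu]_y f (b + c * y)%R = `|c|^-1%:E * \int[mu]_x f x)%E.
Proof.
move=> c0 mf f0.
have c_ge0 : 0 <= `|c|^-1 by rewrite invr_ge0.
rewrite -(ge0_integral_mscale mu measurableT (NngNum c_ge0))//.
transitivity (\int[pushforward mu (aff b c : _ -> measurableTypeR R)]_x f x)%E.
  by rewrite ge0_integral_pushforward//; exact: measurable_aff.
apply: eq_measure_integral => [|maff A mA _]; first exact: measurable_aff.
exact: lebesgue_measure_affine.
Qed.

End affine.

(** * The iterated integral as an integral against one measure *)

Section iterated_integral.
Context {R : realType}.
Local Open Scope ereal_scope.
Local Notation mu := (@lebesgue_measure R).

(** The measure is built by induction: a Dirac mass at the empty tuple, then the image under
    [cons_tuple] of the product of Lebesgue measure with the previous one. Sigma-finiteness is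
    carried along because Tonelli requires it at the next stage. *)
Lemma iint_integral n : exists m : {sigma_finite_measure set (n.-tuple R) -> \bar R},
  forall g : n.-tuple R -> \bar R, measurable_fun setT g -> (forall v, 0 <= g v) ->
    iint g = \int[m]_v g v.
Proof.
elim: n => [|n [m IH]].
  exists (\d_([tuple] : 0.-tuple R)) => g mg g0 /=.
  by rewrite integral_dirac// diracT mul1e.
pose cns (p : R * n.-tuple R) : n.+1.-tuple R := cons_tuple p.1 p.2.
pose uncns (v : n.+1.-tuple R) : R * n.-tuple R := (thead v, [tuple of behead v]).
have mcns : measurable_fun setT cns by exact: measurable_cons.
have muncns : measurable_fun setT uncns.
  by apply: measurable_fun_pair; [exact: measurable_tnth|exact: measurable_behead].
have cnsK : cancel cns uncns.
  by move=> [y v]; rewrite /uncns/cns theadE/=; congr pair; apply: val_inj.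
pose mm : {measure set (measurableTypeR R * n.-tuple R)%type -> \bar R} :=
  mu \x m.
pose q := image_measure mm mcns.
(* Sigma-finiteness is transported from the factors: the sets are preimages under [uncns] of
   products of increasing exhaustions, and [cnsK] reduces their measure to that of a rectangle. *)
have qsf : sigma_finite setT q.
  have /sigma_finiteP[F [TF ndF Foo]] := sigma_finiteT mu.
  have /sigma_finiteP[G [TG ndG Goo]] := sigma_finiteT m.
  exists (fun k => uncns @^-1` (F k `*` G k)).
    rewrite -preimage_bigcup; apply/esym; rewrite -subTset => v _ /=.
    have [i _ Fi] : (\bigcup_k F k) (thead v) by rewrite -TF.
    have [j _ Gj] : (\bigcup_k G k) [tuple of behead v] by rewrite -TG.
    exists (maxn i j) => //; split => /=.
    - by move: Fi; exact/subsetPset/ndF/leq_maxl.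
    - by move: Gj; exact/subsetPset/ndG/leq_maxr.
  move=> k; have [mF Fk] := Foo k; have [mG Gk] := Goo k; split.
    by rewrite -[X in measurable X]setTI; apply: muncns => //; exact: measurableX.
  rewrite -[X in X < _]/(mm ((uncns \o cns) @^-1` (F k `*` G k))).
  rewrite (_ : uncns \o cns = id); last by apply/funext => p; exact: cnsK.
  by rewrite preimage_id /mm /= product_measure1E// lte_mul_pinfty// ge0_fin_numE.
pose q' : {sigma_finite_measure set (n.+1.-tuple R) -> \bar R} :=
  HB.pack (Measure.sort q) (Measure_isSigmaFinite.Build _ _ _ (Measure.sort q) qsf).
exists q' => g mg g0.
have mcns' : @measurable_fun _ _ (measurableTypeR R * n.-tuple R)%type
  (n.+1.-tuple R) setT cns := mcns.
have mgc : @measurable_fun _ _ (measurableTypeR R * n.-tuple R)%type (\bar R)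
  setT (g \o cns) by exact: measurableT_comp mg mcns'.
have -> : \int[q']_v g v = \int[mu \x m]_p (g \o cns) p.
  transitivity (\int[pushforward mm cns]_v g v); first by [].
  have := @ge0_integral_pushforward _ _ _ _ _ _ mcns' mm setT g measurableT mg.
  by rewrite preimage_setT; apply.
rewrite (fubini_tonelli1 _ mgc); last by move=> p; exact: g0.
apply: eq_integral => y _; rewrite /fubini_F.
transitivity (iint (fun v : n.-tuple R => g (cns (y, v)))); first by [].
rewrite IH//; apply: (measurableT_comp mg).
exact: (measurableT_comp mcns (measurable_pair1 y)).
Qed.

End iterated_integral.

(** * From convergence in mean to convergence of bounded continuous functionals *)

Section convergence_in_mean.
Local Open Scope ereal_scope.
Context d (T : measurableType d) (R : realType) (P : probability T R).
Variables (Y_ : nat -> T -> R) (Y : T -> R).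
Hypotheses (mY_ : forall n, measurable_fun setT (Y_ n)) (mY : measurable_fun setT Y).

(** The distances in mean sum to at most 1, so the series of the distances has finite expectation.
    It is therefore finite almost surely, and its terms tend to 0. *)
Lemma cvg_ae_summable_dist (s : nat -> nat) :
  (forall k, \int[P]_w `|Y_ (s k) w - Y w|%:E <= (1 / (2 ^ k.+1)%:R)%:E) ->
  {ae P, forall w, (fun k => Y_ (s k) w) @ \oo --> Y w}.
Proof.
move=> sumY.
have mD k : measurable_fun setT (fun w => `|Y_ (s k) w - Y w|%:E).
  apply/measurable_EFinP; apply: measurableT_comp => //.
  exact: measurable_funB.
have int_sum : P.-integrable setT (fun w => \sum_(k <oo) `|Y_ (s k) w - Y w|%:E).
  apply/integrableP; split.
    by apply: ge0_emeasurable_sum => // k w _ _; rewrite lee_fin.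
  under eq_integral do rewrite gee0_abs ?nneseries_ge0//.
  rewrite integral_nneseries//.
  apply: (@le_lt_trans _ _ 1%E); last exact: ltry.
  apply: le_trans (@epsilon_trick0 R 1 xpredT ler01).
  by apply: lee_nneseries => // k _ _; exact: integral_ge0.
have := integrable_ae measurableT int_sum; apply: filterS => w /(_ Logic.I) fin.
have cvg_series : cvgn (series (fun k => `|Y_ (s k) w - Y w|%R)).
  apply: nondecreasing_is_cvgn.
    exact: nondecreasing_series.
  exists (fine (\sum_(k <oo) `|Y_ (s k) w - Y w|%:E)) => _ [n _ <-].
  rewrite -lee_fin fineK// /series/= -sumEFin.
  by apply: nneseries_lim_ge => k _ _; rewrite lee_fin.
by apply/subr_cvg0; apply: norm_cvg0; exact: cvg_series_cvg_0.
Qed.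

Hypothesis Y_Y : \int[P]_w `|Y_ n w - Y w|%:E @[n --> \oo] --> 0.

(* Every subsequence has a further subsequence along which [Y_] converges almost
   surely, so that dominated convergence applies. *)
Lemma cvg_integral_bounded_continuous (D : set T) (h : R -> R) (M : R) :
  measurable D -> continuous h -> (forall y, `|h y| <= M)%R ->
  \int[P]_(w in D) (h (Y_ n w))%:E @[n --> \oo] --> \int[P]_(w in D) (h (Y w))%:E.
Proof.
move=> mD ch hM.
have mh : measurable_fun setT h by exact: continuous_measurable_fun.
(* Otherwise a neighbourhood [A] of the limit is missed infinitely often, and indices [s k] can be
   chosen whose integrals lie outside [A] while the distances in mean are at most [2^-(k+1)].
   Dominated convergence along [s] contradicts this. *)
apply: contrapT => /existsNP[A] /not_implyP[nA farA].
have sub k : exists n, \int[P]_w `|Y_ n w - Y w|%:E <= (1 / (2 ^ k.+1)%:R)%:E /\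
    ~ A (\int[P]_(w in D) (h (Y_ n w))%:E).
  have e0 : 0 < (1 / (2 ^ k.+1)%:R : R)%:E.
    by rewrite lte_fin divr_gt0// ltr0n expn_gt0.
  have [N _ YN] : \forall n \near \oo,
      \int[P]_w `|Y_ n w - Y w|%:E <= (1 / (2 ^ k.+1)%:R)%:E.
    have nb : nbhs (0 : \bar R) [set x | x <= (1 / (2 ^ k.+1)%:R)%:E].
      apply: (@filterS _ _ _ [set x | x < (1 / (2 ^ k.+1)%:R)%:E]).
        by move=> x /= /ltW.
      apply: open_nbhs_nbhs; split; last exact: e0.
      exact: open_ereal_lt_ereal.
    exact: (Y_Y nb).
  apply: contrapT => /forallNP all_close; apply: farA.
  exists N => // n /= Nn; apply: contrapT => nAn.
  by apply: (all_close n); split => //; exact: YN.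
have [s /all_and2[sY sA]] := choice sub.
have M0 : (0 <= M)%R by rewrite (le_trans _ (hM 0%R)).
have mhY Z : measurable_fun setT Z -> measurable_fun D (fun w => (h (Z w))%:E).
  move=> mZ; apply/measurable_EFinP; apply: (measurable_funS measurableT) => //.
  exact: measurableT_comp.
have ae_cvg : {ae P, forall w, D w ->
    (fun k => (h (Y_ (s k) w))%:E) @ \oo --> (h (Y w))%:E}.
  apply: filterS (cvg_ae_summable_dist sY) => w cw _.
  apply: cvg_EFin; first exact: nearW.
  by apply: continuous_cvg => //; exact: ch.
have ae_le : {ae P, forall w n, D w -> `|(h (Y_ (s n) w))%:E| <= (cst M%:E) w}.
  by apply: aeW => w n _; rewrite lee_fin.
have [_ _ cvs] := @dominated_convergence _ _ _ P D mD _ _ _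
  (fun k => mhY _ (mY_ (s k))) (mhY _ mY) ae_cvg
  (finite_measure_integrable_cst P M mD) ae_le.
by have [N _ /(_ N (leqnn N))] := cvs _ nA; exact: sA.
Qed.

End convergence_in_mean.

(** * Independence of joint variables, of images and of limits *)

Section independence.
Local Open Scope ereal_scope.
Context d d1 (T : measurableType d) (T1 : measurableType d1) (R : realType).
Variable P : probability T R.

(** For fixed [A] both sides are finite measures in [B]. They agree on rectangles, which are stable
    under intersection and generate the product sigma-algebra. *)
Lemma indep2_joint d2 d3 (T2 : measurableType d2) (T3 : measurableType d3)
    (X : T -> T1) (Y : T -> T2) (Z : T -> T3) :
  measurable_fun setT X -> measurable_fun setT Y -> measurable_fun setT Z ->
  indep3 P X Y Z -> indep2 P X (fun w => (Y w, Z w)).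
Proof.
move=> mX mY mZ XYZ A B mA mB.
have mYZ : measurable_fun setT (fun w => (Y w, Z w)) by exact: measurable_fun_pair.
have mXA : measurable (X @^-1` A) by rewrite -[X in measurable X]setTI; exact: mX.
have PXA_ge0 : (0 <= fine (P (X @^-1` A)))%R by exact: fine_ge0.
have PXA_fin : P (X @^-1` A) \is a fin_num by exact: fin_num_measure.
pose m1 := image_measure (mrestr P mXA) mYZ.
pose m2 : {measure set (T2 * T3)%type -> \bar R} :=
  mscale (NngNum PXA_ge0) (image_measure P mYZ).
suff : m1 B = m2 B.
  by rewrite /m1 /m2/= /mscale /mrestr /pushforward/= fineK// setIC.
pose C : set (set (T2 * T3)) :=
  [set C | exists A, measurable A /\ exists B, measurable B /\ C = A `*` B].
have CI : setI_closed C.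
  move=> /= _ _ [X1 [mX1 [X2 [mX2 ->]]]] [Y1 [mY1 [Y2 [mY2 ->]]]].
  rewrite -setXI; exists (X1 `&` Y1); split; first exact: measurableI.
  by exists (X2 `&` Y2); split => //; exact: measurableI.
apply: (measure_unique C (fun=> setT)) => //.
- rewrite measurable_prod_measurableType//; congr (<<s _ >>).
  rewrite predeqE; split => [[A' mA' [B' mB' <-]]|[A' [mA' [B' [mB' ->]]]]].
    by exists A'; split => //; exists B'.
  by exists A' => //; exists B'.
- by move=> _; exists setT; split => //; exists setT; split => //; rewrite setXTT.
- by rewrite bigcup_const.
- move=> _ [B' [mB' [C' [mC' ->]]]].
  rewrite /m1 /m2/= /mscale /mrestr /pushforward/= fineK//.
  (* Taking the whole space as first event shows that [Y] and [Z] are themselves independent. *)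
  have := XYZ setT B' C' measurableT mB' mC'.
  rewrite preimage_setT setTI probability_setT mul1e => YZ.
  rewrite -[X in P (X `&` _)]/(Y @^-1` B' `&` Z @^-1` C').
  rewrite -[X in _ * P X]/(Y @^-1` B' `&` Z @^-1` C').
  by rewrite setIC setIA XYZ// YZ muleA.
- by move=> _; rewrite /m1/= /mrestr /pushforward/= preimage_setT setTI ltey_eq PXA_fin.
Qed.

Lemma indep2_comp d2 d3 (T2 : measurableType d2) (T3 : measurableType d3)
    (X : T -> T1) (Y : T -> T2) (f : T2 -> T3) :
  measurable_fun setT f -> indep2 P X Y -> indep2 P X (f \o Y).
Proof.
move=> mf XY A B mA mB; rewrite comp_preimage XY//.
by rewrite -[X in measurable X]setTI; exact: mf.
Qed.

Section limit.
Variables (X : T -> T1) (Y_ : nat -> T -> R) (Y : T -> R).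
Hypotheses (mX : measurable_fun setT X) (mY_ : forall n, measurable_fun setT (Y_ n)).
Hypotheses (mY : measurable_fun setT Y) (XY_ : \forall n \near \oo, indep2 P X (Y_ n)).
Hypothesis Y_Y : \int[P]_w `|Y_ n w - Y w|%:E @[n --> \oo] --> 0.

(** The product formula holds eventually for [Y_ n]. Both of its sides converge because [h] is
    bounded and continuous, so the limits coincide. *)
Lemma integral_indep2_limit (A : set T1) (h : R -> R) :
  measurable A -> continuous h -> (forall y, 0 <= h y <= 1)%R ->
  \int[P]_(w in X @^-1` A) (h (Y w))%:E = P (X @^-1` A) * \int[P]_w (h (Y w))%:E.
Proof.
move=> mA ch h01.
have mh : measurable_fun setT h by exact: continuous_measurable_fun.
have h0 y : (0 <= h y)%R by have /andP[] := h01 y.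
have h1 y : (`|h y| <= 1)%R by rewrite ger0_norm//; have /andP[] := h01 y.
have mXA : measurable (X @^-1` A) by rewrite -[X in measurable X]setTI; exact: mX.
have PXA_fin : P (X @^-1` A) \is a fin_num by exact: fin_num_measure.
have mh2 : measurable_fun setT (fun z : T1 * R => (\1_A z.1 * h z.2)%:E).
  apply/measurable_EFinP; apply: measurable_funM; exact: measurableT_comp.
have hY_ : \forall n \near \oo, \int[P]_(w in X @^-1` A) (h (Y_ n w))%:E =
    P (X @^-1` A) * \int[P]_w (h (Y_ n w))%:E.
  apply: filterS XY_ => n XYn.
  transitivity (\int[P]_w (\1_A (X w) * h (Y_ n w))%:E).
    rewrite integral_mkcond; apply: eq_integral => w _.
    by rewrite epatch_indic muleC.
  rewrite (ge0_integral_indep2 mX (mY_ n) XYn mh2); last first.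
    by move=> z; rewrite lee_fin mulr_ge0.
  have mhY : measurable_fun setT (fun w => (h (Y_ n w))%:E).
    by apply/measurable_EFinP; exact: measurableT_comp.
  rewrite /=; under eq_integral => w _.
    under eq_integral do rewrite EFinM.
    rewrite ge0_integralZl//; last by move=> w' _; rewrite lee_fin.
    over.
  rewrite ge0_integralZr//; last first.
  - by apply: integral_ge0 => w _; rewrite lee_fin.
  - by apply/measurable_EFinP; apply: (measurableT_comp _ mX); exact: measurable_indic.
  by rewrite -[X in X * _]/(\int[P]_w (\1_(X @^-1` A) w)%:E) integral_indic// setIT.
have cl : \int[P]_(w in X @^-1` A) (h (Y_ n w))%:E @[n --> \oo] -->
    \int[P]_(w in X @^-1` A) (h (Y w))%:E.
  exact: (cvg_integral_bounded_continuous mY_ mY Y_Y mXA ch h1).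
have cr : P (X @^-1` A) * \int[P]_w (h (Y_ n w))%:E @[n --> \oo] -->
    P (X @^-1` A) * \int[P]_w (h (Y w))%:E.
  apply: cvgeZl => //.
  exact: (cvg_integral_bounded_continuous mY_ mY Y_Y measurableT ch h1).
have {}cl : P (X @^-1` A) * \int[P]_w (h (Y_ n w))%:E @[n --> \oo] -->
    \int[P]_(w in X @^-1` A) (h (Y w))%:E.
  by apply: cvg_trans cl; apply: near_eq_cvg; apply: filterS hY_ => n ->.
by move/cvg_lim : cl => <- //; move/cvg_lim : cr => <-.
Qed.

(* [gate x y ^+ n] decreases to the indicator of [x <= y]. *)
Let gate (x y : R) : R := (expR (- (x - y + `|x - y|)))%R.

Let gate_continuous x : continuous (gate x).
Proof.
move=> y; rewrite /gate; apply: continuous_comp; last exact: continuous_expR.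
apply: cvgN; apply: cvgD; last apply: cvg_norm.
all: by apply: cvgB; [exact: cvg_cst|exact: cvg_id].
Qed.

Let gate_ge0 x y : (0 <= gate x y)%R. Proof. exact: expR_ge0. Qed.

Let gate_le1 x y : (gate x y <= 1)%R.
Proof.
rewrite -[leRHS]expR0 ler_expR oppr_le0.
by have := lerNnormlW (lexx `|x - y|%R); lra.
Qed.

Let gate_cvg x y : (gate x y ^+ n)%R @[n --> \oo] --> (\1_(`[x, +oo[%classic) y : R).
Proof.
rewrite indicE mem_setE in_itv/= andbT; have [xy|yx] := leP x y.
  rewrite /gate ler0_norm ?subr_le0// subrr oppr0 expR0.
  by under eq_cvg do rewrite expr1n; exact: cvg_cst.
apply: cvg_expr; rewrite ger0_norm ?gate_ge0//.
rewrite -[ltRHS]expR0 ltr_expR oppr_lt0 ger0_norm ?subr_ge0 ?ltW//.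
by rewrite addr_gt0// subr_gt0.
Qed.

Let gateX01 x n y : (0 <= gate x y ^+ n <= 1)%R.
Proof. by rewrite exprn_ge0//= exprn_ile1. Qed.

Let integral_gate (D : set T) x : measurable D ->
  \int[P]_(w in D) (gate x (Y w) ^+ n)%:E @[n --> \oo] --> P (D `&` Y @^-1` `[x, +oo[).
Proof.
move=> mD.
have mYx : measurable (Y @^-1` `[x, +oo[%classic).
  by rewrite -[X in measurable X]setTI; exact: mY.
have mg n : measurable_fun D (fun w => (gate x (Y w) ^+ n)%:E).
  apply/measurable_EFinP; apply: (measurable_funS measurableT) => //.
  apply: measurable_funX; apply: measurableT_comp => //.
  exact: continuous_measurable_fun.
have mi : measurable_fun D (fun w => (\1_(`[x, +oo[%classic) (Y w))%:E : \bar R).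
  apply/measurable_EFinP; apply: (measurable_funS measurableT) => //.
  by apply: measurableT_comp => //; exact: measurable_indic.
have ae_cvg : {ae P, forall w, D w -> (fun n => (gate x (Y w) ^+ n)%:E) @ \oo -->
    (\1_(`[x, +oo[%classic) (Y w))%:E}.
  by apply: aeW => w _; apply: cvg_EFin; [exact: nearW|exact: gate_cvg].
have ae_le : {ae P, forall w n, D w -> `|(gate x (Y w) ^+ n)%:E| <= (cst 1%:E) w}.
  apply: aeW => w n _; have /andP[g0 g1] := gateX01 x n (Y w).
  by rewrite lee_fin ger0_norm.
have [_ _] := @dominated_convergence _ _ _ P D mD _ _ _ mg mi ae_cvg
  (finite_measure_integrable_cst P 1 mD) ae_le.
by rewrite -[X in _ --> X]/(\int[P]_(w in D) (\1_(Y @^-1` `[x, +oo[) w)%:E)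
  integral_indic// setIC.
Qed.

(** Powers of [gate x] are continuous with values in [[0, 1]], so they factor by the previous lemma.
    Letting the exponent grow gives the product formula for the half-lines [[x, +oo[], an
    intersection-stable family generating the Borel sets. *)
Lemma indep2_limit : indep2 P X Y.
Proof.
move=> A B mA mB.
have mXA : measurable (X @^-1` A) by rewrite -[X in measurable X]setTI; exact: mX.
have PXA_ge0 : (0 <= fine (P (X @^-1` A)))%R by exact: fine_ge0.
have PXA_fin : P (X @^-1` A) \is a fin_num by exact: fin_num_measure.
pose m1 := image_measure (mrestr P mXA) mY.
pose m2 : {measure set R -> \bar R} := mscale (NngNum PXA_ge0) (image_measure P mY).
suff : m1 B = m2 B.
  by rewrite /m1 /m2/= /mscale /mrestr /pushforward/= fineK// setIC.
apply: (measure_unique (@RGenCInfty.G R) (fun k => `[- k%:R, +oo[%classic)%R) => //.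
- exact: RGenCInfty.measurableE.
- move=> _ _ [x ->] [y ->]; exists (Num.max x y).
  by apply/seteqP; split => z /=; rewrite !in_itv/= !andbT ge_max => /andP.
- by move=> k; eexists; reflexivity.
- rewrite -subTset => y _; exists (Num.truncn `|y|).+1 => //=; rewrite in_itv/= andbT.
  have := ltW (truncnS_gt `|y|); have := ler_norm (- y); rewrite normrN; lra.
- move=> _ [x ->].
  rewrite /m1 /m2/= /mscale /mrestr /pushforward/= fineK// setIC.
  have c1 := @integral_gate _ x mXA.
  have c2 : P (X @^-1` A) * \int[P]_w (gate x (Y w) ^+ n)%:E @[n --> \oo] -->
      P (X @^-1` A) * P (Y @^-1` `[x, +oo[).
    by apply: cvgeZl => //; rewrite -[Y @^-1` _]setTI; exact: integral_gate.
  move/cvg_lim : c1 => <- //; move/cvg_lim : c2 => <- //.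
  congr (limn _); apply/funext => n.
  apply: (@integral_indep2_limit A (fun y => gate x y ^+ n)%R) => //.
  move=> y; apply: (@continuous_comp _ _ _ (gate x) (fun z => z ^+ n)%R).
    exact: gate_continuous.
  exact: exprn_continuous.
- move=> k; rewrite /m1/= /mrestr /pushforward/=.
  by rewrite (le_lt_trans (probability_le1 _ _)) ?ltry//; apply: measurableI => //;
    rewrite -[X in measurable X]setTI; exact: mY.
Qed.

End limit.
End independence.

(** * The density of an affine image of [X] plus an independent variable *)

Section density_of_sum.
Local Open Scope ereal_scope.
Context d (T : measurableType d) (R : realType) (P : probability T R).
Local Notation leb := (@lebesgue_measure R).

Lemma indep2_sym d1 d2 (T1 : measurableType d1) (T2 : measurableType d2)
    (X : T -> T1) (Y : T -> T2) : indep2 P X Y -> indep2 P Y X.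
Proof. by move=> XY A B mA mB; rewrite setIC XY// muleC. Qed.

Lemma ge0_integral_is_density (X : T -> R) (f : R -> R) (h : R -> \bar R) :
  measurable_fun setT X -> is_density P X f ->
  measurable_fun setT h -> (forall x, 0 <= h x) ->
  \int[P]_w h (X w) = \int[leb]_x (h x * (f x)%:E).
Proof.
move=> mX [f0 mf fX] mh h0.
exact: (@ge0_integral_density _ _ T (measurableTypeR R) R P leb X mX f f0 mf fX).
Qed.

(** Given [S w], the variable [b + c * X + S w] has density [g ((u - b - S w) / c) / |c|] at [u];
    this is its average over [w]. *)
Definition sum_density (g : R -> R) (b c : R) (S : T -> R) (u : R) : R :=
  (`|c|^-1 * fine (\int[P]_w (g ((u - b - S w) / c))%:E))%R.

Variables (g : R -> R) (M b c : R) (X S : T -> R).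
Hypotheses (gM : forall y, (`|g y| <= M)%R) (c0 : c != 0%R).
Hypotheses (gX : is_density P X g) (mX : measurable_fun setT X).
Hypotheses (mS : measurable_fun setT S).

Let g_ge0 y : (0 <= g y)%R. Proof. by have [] := gX. Qed.

Let mg : measurable_fun setT g. Proof. by have [] := gX. Qed.

Let mgS : measurable_fun setT (fun z : T * R => (`|c|^-1 * g ((z.2 - b - S z.1) / c))%R).
Proof.
apply: measurable_funM => //; apply: (measurableT_comp mg).
apply: measurable_funM => //; apply: measurable_funB; last first.
  exact: (measurableT_comp mS).
exact: measurable_funB.
Qed.

Let mgSu u : measurable_fun setT (fun w => (g ((u - b - S w) / c))%:E).
Proof.
apply/measurable_EFinP; apply: (measurableT_comp mg).
by apply: measurable_funM => //; exact: measurable_funB.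
Qed.

Let int_g_fin u : \int[P]_w (g ((u - b - S w) / c))%:E \is a fin_num.
Proof.
have M0 : (0 <= M)%R by rewrite (le_trans _ (gM 0%R)).
rewrite ge0_fin_numE; last by apply: integral_ge0 => w _; rewrite lee_fin.
apply: (@le_lt_trans _ _ (\int[P]_w (cst M%:E) w)).
  apply: ge0_le_integral => //.
  - by move=> w _; rewrite lee_fin.
  - by move=> w _; rewrite lee_fin (le_trans (ler_norm _)).
by rewrite integral_cst//= probability_setT mule1 ltry.
Qed.

Lemma sum_densityE u : (sum_density g b c S u)%:E =
  \int[P]_w (`|c|^-1 * g ((u - b - S w) / c))%:E.
Proof.
rewrite /sum_density EFinM fineK//.
under [RHS]eq_integral do rewrite EFinM.
by rewrite ge0_integralZl// => *; rewrite lee_fin ?invr_ge0.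
Qed.

Lemma sum_density_ge0 u : (0 <= sum_density g b c S u)%R.
Proof.
rewrite -lee_fin sum_densityE; apply: integral_ge0 => w _.
by rewrite lee_fin !mulr_ge0 ?invr_ge0.
Qed.

Lemma measurable_sum_density : measurable_fun setT (sum_density g b c S).
Proof.
apply/measurable_EFinP; rewrite (_ : _ \o _ = fun u : R =>
    \int[P]_w (`|c|^-1 * g ((u - b - S w) / c))%:E); last first.
  by apply/funext => u /=; rewrite sum_densityE.
apply: (measurable_fun_fubini_tonelli_G (m1 := P)
  (fun z : T * R => (`|c|^-1 * g ((z.2 - b - S z.1) / c))%:E)).
- exact/measurable_EFinP.
- by move=> z; rewrite lee_fin !mulr_ge0 ?invr_ge0.
Qed.

Lemma sum_density_le u : (sum_density g b c S u <= `|c|^-1 * M)%R.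
Proof.
rewrite /sum_density ler_wpM2l ?invr_ge0// -lee_fin fineK//.
apply: (@le_trans _ _ (\int[P]_w (cst M%:E) w)).
  apply: ge0_le_integral => //.
  - by move=> w _; rewrite lee_fin.
  - by move=> w _; rewrite lee_fin (le_trans (ler_norm _)).
by rewrite integral_cst//= probability_setT mule1.
Qed.

Lemma is_density_sum : indep2 P X S ->
  is_density P (fun w => b + c * X w + S w)%R (sum_density g b c S).
Proof.
move=> /indep2_sym SX; split.
- exact: sum_density_ge0.
- exact: measurable_sum_density.
move=> A mA.
pose F (z : R * R) : \bar R := (\1_A (b + c * z.2 + z.1)%R)%:E.
have mV : measurable_fun setT (fun w => b + c * X w + S w)%R.
  by apply: measurable_funD => //; apply: measurable_funD => //; exact: measurable_funM.
have mF : measurable_fun setT F.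
  apply/measurable_EFinP; apply: (measurableT_comp (measurable_indic _)) => //.
  apply: measurable_funD => //; apply: measurable_funD => //.
  exact: measurable_funM.
have F0 z : 0 <= F z by rewrite lee_fin.
transitivity (\int[P]_w F (S w, X w)).
  rewrite -[RHS]/(\int[P]_w (\1_((fun w => b + c * X w + S w)%R @^-1` A) w)%:E).
  rewrite integral_indic ?setIT//.
  by rewrite -[X in measurable X]setTI; exact: mV.
(* Independence freezes [S w] in the inner expectation, which becomes an integral against [g]. The
   substitution [u = b + S w + c * y] then produces the factor [1 / |c|]. *)
rewrite (ge0_integral_indep2 mS mX SX)//.
transitivity (\int[P]_w \int[leb]_u (\1_A u * (`|c|^-1 * g ((u - b - S w) / c)))%:E).
  apply: eq_integral => w _.
  rewrite (ge0_integral_is_density mX gX (h := fun y => F (S w, y)))//; last first.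
    exact: measurableT_comp.
  transitivity (\int[leb]_y (fun u => (\1_A u * g ((u - b - S w) / c))%:E)
      (b + S w + c * y)%R).
    apply: eq_integral => y _; rewrite /F/= -EFinM; congr ((\1_A _ * g _)%R%:E).
      by ring.
    by field.
  have mgA : measurable_fun setT (fun u : R => (\1_A u * g ((u - b - S w) / c))%:E).
    apply/measurable_EFinP; apply: measurable_funM => //.
    apply: (measurableT_comp mg); apply: measurable_funM => //.
    by apply: measurable_funB => //; exact: measurable_funB.
  rewrite [LHS](ge0_integral_affine (b + S w) c0 mgA); last first.
    by move=> u; rewrite lee_fin mulr_ge0.
  rewrite -ge0_integralZl//; last by move=> u _; rewrite lee_fin mulr_ge0.
  by apply: eq_integral => u _; rewrite -EFinM mulrCA.
(* Exchanging the integrals leaves, for each [u], the average over [w] that defines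
   [sum_density]. *)
rewrite (fubini_tonelli (m1 := P) (m2 := leb)
  (fun z : T * R => (\1_A z.2 * (`|c|^-1 * g ((z.2 - b - S z.1) / c)))%:E)); last 2 first.
- apply/measurable_EFinP; apply: measurable_funM => //.
  by apply: (measurableT_comp (measurable_indic _)).
- by move=> z; rewrite lee_fin !mulr_ge0 ?invr_ge0.
rewrite [RHS]integral_mkcond; apply: eq_integral => u _ /=.
rewrite epatch_indic sum_densityE muleC.
under eq_integral do rewrite EFinM.
rewrite ge0_integralZl//.
- by apply/measurable_EFinP/measurable_funM => //; exact/measurable_EFinP/mgSu.
- by move=> w _; rewrite lee_fin !mulr_ge0 ?invr_ge0.
Qed.

End density_of_sum.

(** * The kernel of multiplication by an exponential, and its integrability *)

Section product_with_exponential.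
Local Open Scope ereal_scope.
Context (R : realType).
Local Notation leb := (@lebesgue_measure R).

Section kernel.
Variable f : R -> R.
Hypotheses (f_ge0 : forall x, (0 <= f x)%R) (mf : measurable_fun setT f).

(** As a function of [x], this is the density of [X * expR u] when [X] has density [f]. *)
Definition exp_kernel (x u : R) : R := (f (x * expR (- u)) * expR (- u))%R.

Lemma exp_kernel_ge0 x u : (0 <= exp_kernel x u)%R.
Proof. by rewrite mulr_ge0// expR_ge0. Qed.

Lemma measurable_exp_kernel2 :
  measurable_fun setT (fun z : R * R => exp_kernel z.1 z.2).
Proof.
have mexp : measurable_fun setT (fun z : R * R => expR (- z.2)).
  by apply: measurableT_comp => //; exact: measurableT_comp.
apply: measurable_funM => //; apply: (measurableT_comp mf).
exact: measurable_funM.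
Qed.

Lemma measurable_exp_kernel x : measurable_fun setT (exp_kernel x).
Proof. exact: (measurableT_comp measurable_exp_kernel2 (measurable_pair1 x)). Qed.

Let mkE x : measurable_fun setT (fun u => (exp_kernel x u)%:E).
Proof. by apply/measurable_EFinP; exact: measurable_exp_kernel. Qed.

Hypothesis f_lty : \int[leb]_x (f x)%:E < +oo.

Let J x := \int[leb]_u (exp_kernel x u)%:E.

(** Translating the integration variable by [ln y] replaces [x] by [x * y] in the argument of [f],
    and the outer exponential contributes the factor [y]. *)
Let J_scale (x y : R) : (0 < y)%R -> J x = y%:E * J (x * y)%R.
Proof.
move=> y0; rewrite /J -ge0_integralZl//; last 3 first.
- exact: mkE.
- by move=> u _; rewrite lee_fin exp_kernel_ge0.
- by rewrite lee_fin ltW.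
transitivity (\int[leb]_u (fun v => (y * exp_kernel (x * y) v)%:E) (ln y + 1 * u)%R).
  apply: eq_integral => u _ /=; congr EFin; rewrite /exp_kernel.
  rewrite mul1r opprD expRD [expR (- ln y)]expRN lnK ?posrE//.
  rewrite (_ : x * y * (y^-1 * expR (- u)) = x * expR (- u))%R; last first.
    by field; rewrite gt_eqF.
  by field; rewrite gt_eqF.
have mg : measurable_fun setT (fun v => (y * exp_kernel (x * y) v)%:E).
  by apply/measurable_EFinP/measurable_funM => //; exact: measurable_exp_kernel.
rewrite [LHS](ge0_integral_affine (ln y) (oner_neq0 R) mg); last first.
  by move=> v; rewrite lee_fin mulr_ge0 ?exp_kernel_ge0// ltW.
by rewrite normr1 invr1 mul1e.
Qed.

(* Averaging [J x = y * J (x * y)] over [y] in [[1, 2]] and exchanging the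
   integrals bounds [J x] by [2 * ln 2 / |x| * \int f]. *)
Lemma integral_exp_kernel_lty (x : R) : x != 0%R ->
  \int[leb]_u (exp_kernel x u)%:E < +oo.
Proof.
move=> x0; suff : J x < +oo by [].
have mI : measurable (`[1%R, 2%R]%classic : set R) by [].
pose I1 : R -> R := \1_(`[1%R, 2%R]%classic).
have mI1 : measurable_fun setT I1 by exact: measurable_indic.
have I1_ge0 y : (0 <= I1 y)%R by rewrite /I1.
have I1E_ge0 y : 0 <= (I1 y)%:E by rewrite lee_fin.
have mI1E : measurable_fun setT (fun y => (I1 y)%:E) by exact/measurable_EFinP.
have Jge0 z : 0 <= J z.
  by apply: integral_ge0 => u _; rewrite lee_fin exp_kernel_ge0.
have mk2 : measurable_fun setT (fun z : R * R => (I1 z.1 * exp_kernel (x * z.1) z.2)%:E).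
  apply/measurable_EFinP/measurable_funM; first exact: measurableT_comp.
  have mm : measurable_fun setT (fun z : R * R => (x * z.1, z.2)%R).
    by apply: measurable_fun_pair => //; exact: measurable_funM.
  exact: (measurableT_comp measurable_exp_kernel2 mm).
have k2_ge0 (z : R * R) : 0 <= (I1 z.1 * exp_kernel (x * z.1) z.2)%:E.
  by rewrite lee_fin mulr_ge0// exp_kernel_ge0.
have JI y : \int[leb]_u (I1 y * exp_kernel (x * y) u)%:E = (I1 y)%:E * J (x * y)%R.
  under eq_integral do rewrite EFinM.
  rewrite ge0_integralZl//; first exact: mkE.
  by move=> u _; rewrite lee_fin exp_kernel_ge0.
have -> : J x = \int[leb]_y ((I1 y)%:E * J x).
  rewrite ge0_integralZr//.
  rewrite integral_indic//= setIT lebesgue_measure_itv/= lte_fin ltr1n.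
  by rewrite -EFinB (_ : 2 - 1 = 1)%R ?mul1e//; lra.
apply: (@le_lt_trans _ _ (\int[leb]_y (2%:E * \int[leb]_u (I1 y * exp_kernel (x * y) u)%:E))).
  apply: ge0_le_integral => //.
  - by move=> y _; rewrite mule_ge0.
  - by apply: emeasurable_funM => //; exact/measurable_EFinP.
  - apply: measurable_funeM.
    exact: (measurable_fun_fubini_tonelli_F (m2 := leb) _ mk2).
  move=> y _; rewrite JI muleCA; rewrite /I1 indicE mem_setE in_itv/=.
  have [/andP[y1 y2]|_] := boolP (1 <= y <= 2)%R; last by rewrite !mul0e.
  rewrite !mul1e (J_scale x (lt_le_trans ltr01 y1)).
  by rewrite lee_wpmul2r.
rewrite ge0_integralZl//; last 2 first.
- exact: (measurable_fun_fubini_tonelli_F (m2 := leb) _ mk2).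
- by move=> y _; apply: integral_ge0 => u _; exact: (k2_ge0 (y, u)).
rewrite lte_mul_pinfty//.
rewrite (fubini_tonelli (m1 := leb) (m2 := leb) _ mk2 k2_ge0)/=.
(* Substitute [z = x * expR (- u) * y]: the Jacobian cancels the outer [expR (- u)], so that [u]
   survives only in the indicator. *)
have inner u : \int[leb]_y (I1 y * exp_kernel (x * y) u)%:E =
    (`|x|^-1)%:E * \int[leb]_z (I1 (z * expR u / x)%R * f z)%:E.
  have c0 : (x * expR (- u) != 0)%R by rewrite mulf_neq0// gt_eqF// expR_gt0.
  have mg : measurable_fun setT (fun z : R => (I1 (z * expR u / x)%R * f z * expR (- u))%:E).
    apply/measurable_EFinP/measurable_funM => //; apply/measurable_funM => //.
    by apply: (measurableT_comp mI1); do 2 apply/measurable_funM => //.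
  transitivity (\int[leb]_y (fun z : R => (I1 (z * expR u / x)%R * f z * expR (- u))%:E)
      (0 + x * expR (- u) * y)%R).
    apply: eq_integral => y _ /=; rewrite add0r /exp_kernel.
    have eu : (expR (- u) * expR u = 1)%R by rewrite -expRD addNr expR0.
    rewrite (_ : x * expR (- u) * y * expR u / x = y)%R; last first.
      by rewrite -[RHS]mulr1 -eu; field.
    by rewrite mulrA [(x * y * _)%R]mulrAC.
  rewrite [LHS](ge0_integral_affine 0%R c0 mg); last first.
    by move=> z; rewrite lee_fin !mulr_ge0// expR_ge0.
  have mIf : measurable_fun setT (fun z : R => (I1 (z * expR u / x)%R * f z)%:E).
    apply/measurable_EFinP/measurable_funM => //.
    by apply: (measurableT_comp mI1); do 2 apply/measurable_funM => //.
  have If_ge0 (z : R) : 0 <= (I1 (z * expR u / x)%R * f z)%:E.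
    by rewrite lee_fin mulr_ge0.
  have eu_ge0 : 0 <= (expR (- u) : R)%:E by rewrite lee_fin expR_ge0.
  under eq_integral do rewrite EFinM.
  rewrite ge0_integralZr//.
  rewrite [X in _ * X]muleC muleA -EFinM normrM (ger0_norm (expR_ge0 _)).
  by congr (_%:E * _); field; rewrite ?gt_eqF ?normr_gt0 ?expR_gt0.
under eq_integral do rewrite inner.
have mf2 : measurable_fun setT (fun z : R * R => (I1 (z.2 * expR z.1 / x)%R * f z.2)%:E).
  apply/measurable_EFinP/measurable_funM; last exact: measurableT_comp.
  apply: (measurableT_comp mI1); do 2 apply/measurable_funM => //.
  exact: measurableT_comp.
have f2_ge0 (z : R * R) : 0 <= (I1 (z.2 * expR z.1 / x)%R * f z.2)%:E.
  by rewrite lee_fin mulr_ge0.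
rewrite ge0_integralZl//; last 2 first.
- exact: (measurable_fun_fubini_tonelli_F (m2 := leb) _ mf2).
- by move=> u _; apply: integral_ge0 => z _; exact: (f2_ge0 (u, z)).
rewrite lte_mul_pinfty//.
rewrite (fubini_tonelli (m1 := leb) (m2 := leb) _ mf2 f2_ge0)/=.
apply: (@le_lt_trans _ _ (\int[leb]_z ((ln 2)%:E * (f z)%:E))).
  apply: ge0_le_integral => //.
  - by move=> z _; apply: integral_ge0 => u _; exact: (f2_ge0 (u, z)).
  - exact: (measurable_fun_fubini_tonelli_G (m1 := leb) _ mf2).
  - by apply: measurable_funeM; exact/measurable_EFinP.
  move=> z _; under eq_integral do rewrite EFinM.
  have mIu : measurable_fun setT (fun u : R => (I1 (z * expR u / x)%R)%:E).
    apply/measurable_EFinP; apply: (measurableT_comp mI1).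
    by do 2 apply/measurable_funM => //.
  have fz_ge0 : 0 <= (f z)%:E by rewrite lee_fin.
  rewrite ge0_integralZr//.
  rewrite lee_wpmul2r ?lee_fin//.
  have ln2_ge0 : (0 <= ln 2 :> R)%R by rewrite ln_ge0// ler1n.
  (* If [z / x <= 0] the indicator vanishes. Otherwise [1 <= z * expR u / x <= 2] means that [u]
     lies between [- l] and [ln 2 - l], an interval of length [ln 2] for every [z]. *)
  have [zx|zx] := leP (z / x)%R 0%R.
    rewrite (eq_integral (cst 0)) ?integral0 ?lee_fin// => u _.
    rewrite /I1 indicE mem_setE in_itv/= lt_geF//.
    by rewrite mulrAC (le_lt_trans _ ltr01)// mulr_le0_ge0// expR_ge0.
  pose l := ln (z / x)%R.
  rewrite (_ : (fun u => _) = EFin \o \1_(`[(- l)%R, (ln 2 - l)%R]%classic)).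
    rewrite integral_indic//= setIT lebesgue_measure_itv/= lte_fin.
    by case: ifP => _; rewrite ?lee_fin// opprK addrNK.
  apply/funext => u /=; congr EFin; rewrite /I1 !indicE !mem_setE !in_itv/=.
  congr (_%:R); congr (nat_of_bool _).
  have -> : (z * expR u / x = expR (l + u))%R.
    by rewrite expRD lnK ?posrE// mulrAC.
  have E2 : (expR (ln 2) = 2 :> R)%R by rewrite lnK// posrE.
  congr andb; last by rewrite -[in LHS]E2 ler_expR lerBrDl.
  by rewrite -[in LHS](@expR0 R) ler_expR -lerBlDl sub0r.
have fE_ge0 z : 0 <= (f z)%:E by rewrite lee_fin.
have mfE : measurable_fun setT (fun z => (f z)%:E) by exact/measurable_EFinP.
have ln2_ge0 : 0 <= (ln 2 : R)%:E by rewrite lee_fin ln_ge0// ler1n.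
rewrite ge0_integralZl//.
by rewrite lte_mul_pinfty// lee_fin ln_ge0// ler1n.
Qed.

End kernel.
End product_with_exponential.

(** * Mixtures of the exponential kernel and their limits *)

Section mixture.
Local Open Scope ereal_scope.
Context (R : realType).
Local Notation leb := (@lebesgue_measure R).
Variable f : R -> R.
Hypotheses (f_ge0 : forall x, (0 <= f x)%R) (mf : measurable_fun setT f).
Hypothesis f_lty : \int[leb]_x (f x)%:E < +oo.

(** The candidate density of [X * expR K] for independent [X] and [K] with densities [f] and [k]:
    the densities of [X * expR u], averaged against [k]. *)
Definition exp_mixture (k : R -> R) (x : R) : \bar R :=
  \int[leb]_u (exp_kernel f x u * k u)%:E.

Lemma exp_mixture_ge0 k x : (forall u, (0 <= k u)%R) -> 0 <= exp_mixture k x.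
Proof.
move=> k0; apply: integral_ge0 => u _.
by rewrite lee_fin mulr_ge0// exp_kernel_ge0.
Qed.

Lemma measurable_exp_mixture2 (k : R -> R) : measurable_fun setT k ->
  measurable_fun setT (fun z : R * R => (exp_kernel f z.1 z.2 * k z.2)%:E).
Proof.
move=> mk; apply/measurable_EFinP/measurable_funM.
  exact: measurable_exp_kernel2.
exact: measurableT_comp.
Qed.

Lemma integrable_exp_kernelM (B x : R) : x != 0%R -> (0 <= B)%R ->
  leb.-integrable setT (fun u => (exp_kernel f x u * B)%:E).
Proof.
move=> x0 B0.
have mk : measurable_fun setT (fun u => (exp_kernel f x u)%:E).
  by apply/measurable_EFinP; exact: measurable_exp_kernel.
have k_ge0 u : 0 <= (exp_kernel f x u)%:E by rewrite lee_fin exp_kernel_ge0.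
apply/integrableP; split.
  by apply/measurable_EFinP/measurable_funM => //; exact: measurable_exp_kernel.
under eq_integral => u _.
  rewrite gee0_abs; last by rewrite EFinM mule_ge0// lee_fin.
  rewrite EFinM.
  over.
rewrite ge0_integralZr// ?lee_fin//.
rewrite muleC lte_mul_pinfty ?lee_fin//.
exact: integral_exp_kernel_lty.
Qed.

(** Dominated convergence with the bound [exp_kernel f x u * B], integrable in [u] since [x != 0].
    Finiteness of the limit is recorded so that [fine] can be taken later. *)
Lemma cvg_exp_mixture (k_ : nat -> R -> R) (k : R -> R) (B x : R) :
  x != 0%R -> (forall n, measurable_fun setT (k_ n)) -> measurable_fun setT k ->
  (forall n u, (0 <= k_ n u <= B)%R) -> (forall u, k_ ^~ u @ \oo --> k u) ->
  exp_mixture (k_ n) x @[n --> \oo] --> exp_mixture k x /\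
  exp_mixture k x \is a fin_num.
Proof.
move=> x0 mk_ mk k_B k_k.
have B0 : (0 <= B)%R by have /andP[/le_trans] := k_B 0%N 0%R; apply.
have mm q : measurable_fun setT q ->
    measurable_fun setT (fun u => (exp_kernel f x u * q u)%:E).
  move=> mq; apply/measurable_EFinP/measurable_funM => //.
  exact: measurable_exp_kernel.
have ae_cvg : {ae leb, forall u, setT u ->
    (fun n => (exp_kernel f x u * k_ n u)%:E) @ \oo --> (exp_kernel f x u * k u)%:E}.
  apply: aeW => u _; apply: cvg_EFin; first exact: nearW.
  by apply: cvgM; [exact: cvg_cst|exact: k_k].
have ae_le : {ae leb, forall u n, setT u ->
    `|(exp_kernel f x u * k_ n u)%:E| <= (exp_kernel f x u * B)%:E}.
  apply: aeW => u n _; have /andP[k0 kB] := k_B n u.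
  rewrite gee0_abs ?lee_fin ?mulr_ge0 ?exp_kernel_ge0//.
  by rewrite ler_wpM2l// exp_kernel_ge0.
have [intk _ cvk] := @dominated_convergence _ _ _ leb setT measurableT _ _ _
  (fun n => mm _ (mk_ n)) (mm _ mk) ae_cvg (integrable_exp_kernelM x0 B0) ae_le.
split; first exact: cvk.
exact: (integrable_fin_num measurableT intk).
Qed.

End mixture.

(** * The density of [X * expR K] *)

Section density_of_product.
Local Open Scope ereal_scope.
Context d (T : measurableType d) (R : realType) (P : probability T R).
Local Notation leb := (@lebesgue_measure R).
Variables (f k : R -> R) (X K : T -> R).
Hypotheses (mX : measurable_fun setT X) (mK : measurable_fun setT K).
Hypotheses (fX : is_density P X f) (kK : is_density P K k) (XK : indep2 P X K).
Hypothesis mix_fin : forall x, x != 0%R -> exp_mixture f k x \is a fin_num.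

(* At the null point [x = 0] the mixture may be infinite; [fine] then gives [0]. *)
Lemma is_density_mul_expR :
  is_density P (fun w => X w * expR (K w))%R (fun x => fine (exp_mixture f k x)).
Proof.
have [f_ge0 mf _] := fX; have [k_ge0 mk _] := kK.
have mm2 := measurable_exp_mixture2 mf mk.
have mm2_ge0 (z : R * R) : 0 <= (exp_kernel f z.1 z.2 * k z.2)%:E.
  by rewrite lee_fin mulr_ge0// exp_kernel_ge0.
have mmix : measurable_fun setT (exp_mixture f k).
  exact: (measurable_fun_fubini_tonelli_F (m2 := leb) _ mm2).
have mfine : measurable_fun setT (fun x => fine (exp_mixture f k x)).
  exact: (measurableT_comp _ mmix).
split => //.
  by move=> x; rewrite fine_ge0// exp_mixture_ge0.
move=> A mA.
have mI : measurable_fun setT (\1_A : R -> R) by exact: measurable_indic.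
pose F (z : R * R) : \bar R := (\1_A (z.2 * expR z.1)%R)%:E.
have mV : measurable_fun setT (fun w => X w * expR (K w))%R.
  by apply: measurable_funM => //; exact: measurableT_comp.
have mF : measurable_fun setT F.
  apply/measurable_EFinP; apply: (measurableT_comp mI).
  by apply: measurable_funM => //; exact: measurableT_comp.
have F0 z : 0 <= F z by rewrite lee_fin.
transitivity (\int[P]_w F (K w, X w)).
  rewrite -[RHS]/(\int[P]_w (\1_((fun w => X w * expR (K w))%R @^-1` A) w)%:E).
  rewrite integral_indic ?setIT//.
  by rewrite -[X in measurable X]setTI; exact: mV.
rewrite (ge0_integral_indep2 mK mX (indep2_sym XK))//.
pose G u := \int[leb]_x (\1_A x * exp_kernel f x u)%:E.
have mG2 : measurable_fun setT (fun z : R * R => (\1_A z.1 * exp_kernel f z.1 z.2)%:E).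
  apply/measurable_EFinP/measurable_funM; first exact: measurableT_comp.
  exact: measurable_exp_kernel2.
have G2_ge0 (z : R * R) : 0 <= (\1_A z.1 * exp_kernel f z.1 z.2)%:E.
  by rewrite lee_fin mulr_ge0// exp_kernel_ge0.
have mG : measurable_fun setT G.
  exact: (measurable_fun_fubini_tonelli_G (m1 := leb) _ mG2).
have G_ge0 u : 0 <= G u by apply: integral_ge0 => x _; exact: (G2_ge0 (x, u)).
(* [G u] is the probability that [X * expR u] falls in [A]; it is obtained by rescaling [X] with
   [K w] frozen. *)
transitivity (\int[P]_w G (K w)).
  apply: eq_integral => w _.
  rewrite (ge0_integral_is_density mX fX (h := fun y => F (K w, y)))//; last first.
    exact: measurableT_comp.
  have e0 : expR (K w) != 0%R by rewrite gt_eqF// expR_gt0.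
  have ee : (expR (K w) * expR (- K w) = 1)%R by rewrite -expRD subrr expR0.
  have mh : measurable_fun setT (fun x : R => (\1_A x * f (x * expR (- K w)))%:E).
    apply/measurable_EFinP/measurable_funM => //.
    by apply: (measurableT_comp mf); exact: measurable_funM.
  have h_ge0 (x : R) : 0 <= (\1_A x * f (x * expR (- K w)))%:E.
    by rewrite lee_fin mulr_ge0.
  transitivity (\int[leb]_z (fun x : R => (\1_A x * f (x * expR (- K w)))%:E)
      (0 + expR (K w) * z)%R).
    apply: eq_integral => z _; rewrite /F/= -EFinM add0r [(expR _ * z)%R]mulrC.
    by rewrite -mulrA ee mulr1.
  rewrite [LHS](ge0_integral_affine 0%R e0 mh)// -ge0_integralZl//.
  apply: eq_integral => x _; rewrite -EFinM /exp_kernel; congr EFin.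
  by rewrite ger0_norm ?expR_ge0// -expRN mulrC mulrA.
rewrite (ge0_integral_is_density mK kK)//.
transitivity (\int[leb]_u \int[leb]_x (\1_A x * (exp_kernel f x u * k u))%:E).
  apply: eq_integral => u _; rewrite /G -ge0_integralZr ?lee_fin//; last 2 first.
  - apply/measurable_EFinP/measurable_funM => //.
    exact: (measurableT_comp (measurable_exp_kernel2 mf) (measurable_pair2 u)).
  - by move=> x _; exact: (G2_ge0 (x, u)).
  by apply: eq_integral => x _; rewrite -EFinM -mulrA.
have mA2 : measurable_fun setT
    (fun z : R * R => (\1_A z.1 * (exp_kernel f z.1 z.2 * k z.2))%:E).
  apply/measurable_EFinP/measurable_funM; first exact: measurableT_comp.
  exact/measurable_EFinP.
have A2_ge0 (z : R * R) : 0 <= (\1_A z.1 * (exp_kernel f z.1 z.2 * k z.2))%:E.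
  by rewrite lee_fin !mulr_ge0// exp_kernel_ge0.
rewrite -(fubini_tonelli (m1 := leb) (m2 := leb) _ mA2 A2_ge0)/=.
transitivity (\int[leb]_(x in A) exp_mixture f k x).
  rewrite [RHS]integral_mkcond; apply: eq_integral => x _ /=.
  rewrite epatch_indic muleC /exp_mixture -ge0_integralZl ?lee_fin//.
  - exact: (measurableT_comp mm2 (measurable_pair1 x)).
  - by move=> u _; exact: (mm2_ge0 (x, u)).
(* Passing to [fine] can alter the integrand only at 0, a null set. *)
apply: ae_eq_integral => //.
- exact: (measurable_funS measurableT).
- by apply: (measurable_funS measurableT) => //; exact/measurable_EFinP.
exists [set 0%R]; split => //; first exact: lebesgue_measure_set1.
move=> x /= h; apply: contrapT => /eqP x0; apply: h => _.
by rewrite fineK// mix_fin.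
Qed.

End density_of_product.

(** * Square-integrability on a set of finite measure *)

Section finite_measure_L2.
Local Open Scope ereal_scope.
Context d (T : measurableType d) (R : realType) (mu : {measure set T -> \bar R}).
Variables (D : set T) (mD : measurable D).
Hypothesis muD : mu D < +oo.

Let norm_le_sqr (e r : R) : (0 < e)%R -> (`|r| <= e + e^-1 * r ^+ 2)%R.
Proof.
move=> e0; rewrite -real_normK ?num_real// -(ler_pM2l e0) mulrDr mulrA.
rewrite divff ?gt_eqF// mul1r.
have := sqr_ge0 (`|r| - e); rewrite sqrrB.
have : (0 <= `|r| * e)%R by rewrite mulr_ge0// ltW.
have : (0 <= `|r| ^+ 2)%R by rewrite sqr_ge0.
have := sqr_ge0 e; lra.
Qed.

(** A substitute for Cauchy-Schwarz, from [(|r| - e)^2 >= 0]. With [e = 1] it embeds L^2 in L^1;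
    with small [e] it turns L^2 convergence into L^1 convergence. *)
Lemma integral_norm_le_sqr (r : T -> R) (e : R) : measurable_fun D r -> (0 < e)%R ->
  \int[mu]_(x in D) `|r x|%:E <=
    e%:E * mu D + e^-1%:E * \int[mu]_(x in D) (r x ^+ 2)%:E.
Proof.
move=> mr e0.
have mr2 : measurable_fun D (fun x => (r x ^+ 2)%:E).
  by apply/measurable_EFinP; exact: measurable_funX.
have ei0 : (0 <= e^-1)%R by rewrite invr_ge0 ltW.
have r2_ge0 x : D x -> 0 <= (r x ^+ 2)%:E by rewrite lee_fin sqr_ge0.
rewrite -integral_cst// -ge0_integralZl//.
rewrite -ge0_integralD//; last 3 first.
- by move=> x _; rewrite lee_fin ltW.
- by move=> x Dx; rewrite mule_ge0// r2_ge0.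
- exact: measurable_funeM.
apply: ge0_le_integral => //.
- by apply/measurable_EFinP; exact: measurableT_comp.
- by apply: emeasurable_funD => //; exact: measurable_funeM.
- by move=> x Dx; rewrite /= -EFinM -EFinD lee_fin norm_le_sqr.
Qed.

Lemma integrable_sqr (r : T -> R) : measurable_fun D r ->
  \int[mu]_(x in D) (r x ^+ 2)%:E < +oo -> mu.-integrable D (EFin \o r).
Proof.
move=> mr r2; apply/integrableP; split; first exact/measurable_EFinP.
rewrite (le_lt_trans (integral_norm_le_sqr mr ltr01))// invr1 !mul1e.
by rewrite lte_add_pinfty.
Qed.

Lemma cvg_integral_norm (r_ : nat -> T -> R) : (forall n, measurable_fun D (r_ n)) ->
  \int[mu]_(x in D) (r_ n x ^+ 2)%:E @[n --> \oo] --> 0 ->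
  \int[mu]_(x in D) `|r_ n x|%:E @[n --> \oo] --> 0.
Proof.
move=> mr r2.
have muD_fin : mu D \is a fin_num by rewrite ge0_fin_numE.
have near_le e : (0 < e)%R ->
    \forall n \near \oo, \int[mu]_(x in D) `|r_ n x|%:E <= e%:E.
  move=> e0; pose C := fine (mu D); have C0 : (0 <= C)%R by exact: fine_ge0.
  (* With this [del] the term [del * mu D] is at most [e / 2], and a squared norm below
     [del * (e / 2)] bounds the other term by [e / 2]. The [+ 1] covers [mu D = 0]. *)
  pose del := (e / 2 / (C + 1))%R.
  have C1 : (0 < C + 1)%R by rewrite ltr_wpDl.
  have del0 : (0 < del)%R by rewrite !divr_gt0.
  have de0 : (0 < del * (e / 2))%R by rewrite mulr_gt0// divr_gt0.
  have nb : nbhs (0 : \bar R) [set x | x < (del * (e / 2))%:E].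
    apply: open_nbhs_nbhs; split; first exact: open_ereal_lt_ereal.
    by rewrite /= lte_fin.
  have near_r2 : \forall n \near \oo,
      \int[mu]_(x in D) (r_ n x ^+ 2)%:E < (del * (e / 2))%:E by exact: (r2 _ nb).
  apply: filterS near_r2 => n r2n.
  rewrite (le_trans (integral_norm_le_sqr (mr n) del0))//.
  rewrite (_ : e%:E = (e / 2)%:E + (del^-1 * (del * (e / 2)))%:E); last first.
    by rewrite -EFinD mulKf ?gt_eqF// -splitr.
  apply: leeD.
    rewrite -(fineK muD_fin) -EFinM lee_fin.
    have : (del * C <= e / 2)%R; last by [].
    by rewrite mulrAC ler_pdivrMr// ler_wpM2l ?lerDl// divr_ge0// ltW.
  by rewrite EFinM lee_wpmul2l ?lee_fin ?invr_ge0 ?ltW.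
have int_ge0 n : 0 <= \int[mu]_(x in D) `|r_ n x|%:E.
  by apply: integral_ge0 => x _; rewrite lee_fin.
apply/fine_cvgP; split.
  apply: filterS (near_le 1%R ltr01) => n n1.
  by rewrite ge0_fin_numE// (le_lt_trans n1)// ltry.
apply/cvgrPdist_le => e e0.
apply: filterS (near_le e e0) => n ne.
rewrite sub0r normrN ger0_norm ?fine_ge0// -lee_fin fineK//.
by rewrite ge0_fin_numE// (le_lt_trans ne)// ltry.
Qed.

Lemma Rintegral_sum (I : Type) (s : seq I) (F : I -> T -> R) :
  (forall i, mu.-integrable D (EFin \o F i)) ->
  mu.-integrable D (EFin \o (fun x => \sum_(i <- s) F i x)%R) /\
  (\int[mu]_(x in D) (\sum_(i <- s) F i x) = \sum_(i <- s) \int[mu]_(x in D) F i x)%R.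
Proof.
move=> iF; elim: s => [|i s [IHi IH]].
  split; first by under eq_fun do rewrite big_nil; exact: integrable0.
  rewrite big_nil (@eq_Rintegral _ _ _ _ D (fun=> 0%R)) ?Rintegral_cst ?mul0r// => x _.
  by rewrite big_nil.
split.
  rewrite (_ : EFin \o _ = (EFin \o F i) \+
      (EFin \o (fun x => \sum_(i <- s) F i x)%R)); first exact: integrableD.
  by apply/funext => x /=; rewrite big_cons EFinD.
rewrite big_cons -IH -RintegralD//.
by apply: eq_Rintegral => x _; rewrite big_cons.
Qed.

End finite_measure_L2.

(** * The integrated Karhunen-Loeve expansion converges in mean *)

Section Karhunen_Loeve.
Local Open Scope ereal_scope.
Context d (Om : measurableType d) (R : realType) (P : probability Om R).
Local Notation leb := (@lebesgue_measure R).
Variables (t0 t1 t : R) (a : R -> Om -> R).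
Hypothesis tt1 : (t <= t1)%R.
Let D : set (R * Om) := `[t0, t1] `*` [set: Om].
Hypothesis ma : measurable_fun D (fun p => a p.1 p.2).
Hypothesis a_L2 : \int[leb \x P]_(p in D) ((a p.1 p.2) ^+ 2)%:E < +oo.

Let I1 : set (measurableTypeR R) := `[t0, t1]%classic.
Let It : set (measurableTypeR R) := `[t0, t]%classic.

Let mI1 : measurable I1. Proof. exact: measurable_itv. Qed.
Let mIt : measurable It. Proof. exact: measurable_itv. Qed.
Let ItI1 : It `<=` I1.
Proof.
move=> s; rewrite /It /I1 /= !in_itv/= => /andP[-> st].
exact: le_trans st tt1.
Qed.

Let lebI1 : leb I1 < +oo.
Proof. by rewrite /I1 lebesgue_measure_itv/=; case: ifP => _; rewrite -?EFinB ltry. Qed.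

Let mD : @measurable _ (measurableTypeR R * Om)%type D.
Proof. exact: measurableX. Qed.

Let measD : (leb \x P) D < +oo.
Proof. by rewrite product_measure1E//= probability_setT mule1. Qed.

(** Extension by zero, so that Fubini's theorem can be used on the whole product space. *)
Let aD : R * Om -> \bar R := (fun p => (a p.1 p.2)%:E) \_ D.

Let maE : @measurable_fun _ _ (measurableTypeR R * Om)%type (\bar R) D
  (fun p => (a p.1 p.2)%:E).
Proof. exact/measurable_EFinP. Qed.

Let int_aD : (leb \x P).-integrable setT aD.
Proof.
apply/(integrable_mkcond _ mD).
exact: (@integrable_sqr _ _ _ (leb \x P) D mD measD (fun p => a p.1 p.2)).
Qed.

Let aDE s w : I1 s -> aD (s, w) = (a s w)%:E.
Proof. by move=> I1s; rewrite /aD patchE mem_set. Qed.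

Let ae_int_a : {ae P, forall w, leb.-integrable I1 (fun s => (a s w)%:E)}.
Proof.
have := ae_integrable2 int_aD; apply: filterS => w.
move=> /(integrableS measurableT mI1 (@subsetT _ _)); apply: eq_integrable => //.
by move=> s /set_mem I1s; rewrite aDE.
Qed.

Let int_mean : leb.-integrable I1 (fun s => (mean_fun P a s)%:E).
Proof.
have iF := integrable_fubini_F int_aD.
have {}iF := integrableS measurableT mI1 (@subsetT _ _) iF.
have meanE s : I1 s -> mean_fun P a s = fine (fubini_F P aD s).
  move=> I1s; rewrite /mean_fun /fubini_F; congr fine.
  by apply: eq_integral => w _; rewrite aDE.
apply: (@le_integrable _ _ _ _ _ mI1 _ (fubini_F P aD)) => //.
- apply/measurable_EFinP.
  apply: (eq_measurable_fun (fun s => fine (fubini_F P aD s))).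
    by move=> s /set_mem /meanE ->.
  exact: (measurableT_comp _ (measurable_int _ iF)).
- move=> s I1s; rewrite meanE//.
  by case: (fubini_F P aD s) => [r| |]//=; rewrite ?leey// abse0.
Qed.

Definition path_integral (w : Om) : R := intI t0 t (fun s => a s w).

Lemma measurable_path_integral : measurable_fun setT path_integral.
Proof.
pose aDt : R * Om -> \bar R := aD \_ (It `*` setT).
have int_aDt : (leb \x P).-integrable setT aDt.
  have mDt : @measurable _ (measurableTypeR R * Om)%type (It `*` setT).
    exact: measurableX.
  by apply/(integrable_mkcond _ mDt); exact: (integrableS measurableT).
have mG := measurable_fubini_G int_aDt.
rewrite (_ : path_integral = fine \o fubini_G leb aDt).
  exact: (measurableT_comp _ mG).
apply/funext => w; rewrite /path_integral /intI /fubini_G/=; congr fine.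
rewrite integral_mkcond; apply: eq_integral => s _.
rewrite /aDt !patchE; case: ifPn => [/set_mem Its|nIts].
  by rewrite mem_set//= aDE//; exact: ItI1.
by rewrite memNset// => -[/= Its _]; move: nIts; rewrite mem_set.
Qed.

Variables (nu : nat -> R) (phi : nat -> R -> R) (xi : nat -> Om -> R).
Hypothesis mphi : forall j, measurable_fun `[t0, t1] (phi j.+1).
Hypothesis phi_norm : forall j, intI t0 t1 (fun s => phi j.+1 s * phi j.+1 s)%R = 1%R.
Hypothesis mxi : forall j, measurable_fun setT (xi j.+1).

Let int_phi j : leb.-integrable I1 (EFin \o phi j.+1).
Proof.
apply: (integrable_sqr mI1 lebI1); first exact: mphi.
have -> : \int[leb]_(s in I1) (phi j.+1 s ^+ 2)%:E =
    \int[leb]_(s in I1) (phi j.+1 s * phi j.+1 s)%:E.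
  by apply: eq_integral => s _; rewrite expr2.
(* [intI] reads an infinite integral as 0, so the value 1 in [phi_norm] excludes it. *)
rewrite ltey; apply/eqP => phi_y; have /eqP := phi_norm j.
by rewrite /intI -/I1 phi_y /= eq_sym oner_eq0.
Qed.

(** The indices are shifted: [KL_coef j] is the coefficient of [xi j.+1]. *)
Definition KL_coef (j : nat) : R := (Num.sqrt (nu j.+1) * intI t0 t (phi j.+1))%R.

Let integrable_term (q : R) j : leb.-integrable It (EFin \o (fun s => q * phi j.+1 s)%R).
Proof.
rewrite (_ : _ \o _ = (fun s => q%:E * (EFin \o phi j.+1) s)); last first.
  by apply/funext => s /=; rewrite EFinM.
by apply: integrableZl => //; exact: (integrableS mI1).
Qed.

Let Rintegral_terms N (v : 'I_N -> R) :
  leb.-integrable It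
    (EFin \o (fun s => \sum_(i < N) Num.sqrt (nu i.+1) * phi i.+1 s * v i)%R) /\
  (\int[leb]_(s in It) (\sum_(i < N) Num.sqrt (nu i.+1) * phi i.+1 s * v i) =
   \sum_(i < N) KL_coef i * v i)%R.
Proof.
have [iS ES] := @Rintegral_sum _ _ _ leb It mIt _ (index_enum 'I_N)
  (fun i s => Num.sqrt (nu i.+1) * v i * phi i.+1 s)%R
  (fun i => integrable_term _ i).
have sumE s : (\sum_(i < N) Num.sqrt (nu i.+1) * phi i.+1 s * v i =
    \sum_(i < N) Num.sqrt (nu i.+1) * v i * phi i.+1 s)%R.
  by apply: eq_bigr => i _; rewrite mulrAC.
split; first by under eq_fun do rewrite sumE.
under eq_Rintegral do rewrite sumE.
rewrite ES; apply: eq_bigr => i _.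
rewrite RintegralZl//; last exact: (integrableS mI1).
by rewrite /KL_coef mulrAC.
Qed.

Lemma K_aE N (v : N.-tuple R) : K_a (mean_fun P a) nu phi t0 t v =
  (intI t0 t (mean_fun P a) + \sum_(i < N) KL_coef i * tnth v i)%R.
Proof.
have [iS ES] := Rintegral_terms (tnth v).
rewrite -ES; apply: (@RintegralD _ _ _ leb It) => //.
exact: (integrableS mI1).
Qed.

Definition KL_partial (N : nat) (w : Om) : R :=
  (intI t0 t (mean_fun P a) + \sum_(i < N) KL_coef i * xi i.+1 w)%R.

Lemma measurable_KL_partial N : measurable_fun setT (KL_partial N).
Proof.
apply: measurable_funD => //; apply: measurable_sum => i.
exact: measurable_funM.
Qed.

Let rest N (p : R * Om) : R := (a p.1 p.2 - mean_fun P a p.1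
  - \sum_(j < N) Num.sqrt (nu j.+1) * phi j.+1 p.1 * xi j.+1 p.2)%R.

Hypothesis KL_conv :
  \int[leb \x P]_(p in D) ((rest N p) ^+ 2)%:E @[N --> \oo] --> 0.

Let mrest N : @measurable_fun _ _ (measurableTypeR R * Om)%type R D (rest N).
Proof.
have fstD (g : R -> R) : @measurable_fun _ _ (measurableTypeR R) R I1 g ->
    @measurable_fun _ _ (measurableTypeR R * Om)%type R D (fun p => g p.1).
  move=> mg; apply: (measurable_comp mI1 _ mg) => //.
    by move=> _ [p [Dp _] <-].
  exact: (measurable_funS measurableT).
apply: measurable_funB; first apply: measurable_funB.
- exact: ma.
- by apply: fstD; apply/measurable_EFinP; exact: (measurable_int _ int_mean).
- apply: measurable_sum => i; apply: measurable_funM; last first.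
    apply: (measurable_funS measurableT) => //.
    exact: (measurableT_comp (mxi i)).
  by apply: measurable_funM => //; apply: fstD; exact: mphi.
Qed.

(** The difference is, up to sign and almost surely, the integral of [rest N] over [[t0, t]]. Its
    mean absolute value is thus at most the L^1 norm of [rest N] on [D], which tends to 0 because
    its L^2 norm does and [D] has finite measure. *)
Lemma cvg_KL_partial :
  \int[P]_w `|KL_partial N w - path_integral w|%:E @[N --> \oo] --> 0.
Proof.
pose rD N := (fun p => `|rest N p|%:E) \_ D.
have mrD N : @measurable_fun _ _ (measurableTypeR R * Om)%type (\bar R) setT (rD N).
  apply: (measurable_restrictT _ mD).1; apply/measurable_EFinP.
  exact: (measurableT_comp _ (mrest N)).
have rD_ge0 N p : 0 <= rD N p.
  by rewrite /rD patchE; case: ifPn => // _; rewrite lee_fin.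
apply: (@squeeze_cvge _ _ _ _ (cst 0) _
  (fun N => \int[leb \x P]_(p in D) `|rest N p|%:E)); last 2 first.
- exact: cvg_cst.
- exact: (cvg_integral_norm mD measD mrest).
apply: nearW => N; apply/andP; split.
  by apply: integral_ge0 => w _; rewrite lee_fin.
rewrite [leRHS]integral_mkcond [leRHS](fubini_tonelli2 _ (mrD N) (rD_ge0 N)).
have mG : measurable_fun setT (fubini_G leb (rD N)).
  exact: measurable_fun_fubini_tonelli_G.
apply: ae_ge0_le_integral => //.
- apply/measurable_EFinP; apply: measurableT_comp => //.
  by apply: measurable_funB; [exact: measurable_KL_partial|exact: measurable_path_integral].
- by move=> w _; apply: integral_ge0 => s _; exact: rD_ge0.
(* Only for integrable paths can the integral of [rest N] be split into its terms; by Fubini these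
   are almost all paths. *)
apply: filterS ae_int_a => w ia _.
have [iS ES] := Rintegral_terms (fun i : 'I_N => xi i.+1 w).
have iat : leb.-integrable It (EFin \o (fun s => a s w)) by exact: (integrableS mI1).
have imt : leb.-integrable It (EFin \o mean_fun P a) by exact: (integrableS mI1).
have iam : leb.-integrable It (EFin \o (fun s => a s w - mean_fun P a s)%R).
  rewrite (_ : _ \o _ = (EFin \o (fun s => a s w)) \- (EFin \o mean_fun P a)).
    exact: integrableB.
  by apply/funext => s /=; rewrite EFinB.
have -> : (KL_partial N w - path_integral w =
    - \int[leb]_(s in It) rest N (s, w))%R.
  rewrite /rest (@RintegralB _ _ _ leb It)// (@RintegralB _ _ _ leb It)// ES.
  by rewrite /KL_partial /path_integral /intI /Rintegral; ring.
have ir : leb.-integrable It (EFin \o (fun s => rest N (s, w))).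
  rewrite (_ : _ \o _ = (EFin \o (fun s => a s w - mean_fun P a s)%R) \- (EFin \o
    (fun s => \sum_(i < N) Num.sqrt (nu i.+1) * phi i.+1 s * xi i.+1 w)%R)).
    exact: integrableB.
  by apply/funext => s /=; rewrite EFinB.
rewrite normrN (@EFin_normr_Rintegral _ _ _ leb)//.
apply: (le_trans (le_abse_integral _ mIt (measurable_int _ ir))).
rewrite /fubini_G [leLHS]integral_mkcond.
apply: ge0_le_integral => //.
- by move=> s _; apply: erestrict_ge0 => s' _.
- apply: (measurable_restrictT _ mIt).1.
  by apply: measurableT_comp => //; exact: (measurable_int _ ir).
- exact: (measurableT_comp (mrD N) (measurable_pair2 w)).
move=> s _; rewrite /rD !patchE; case: ifPn => [/set_mem Its|_]; last exact: rD_ge0.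
by rewrite mem_set//; split => //=; exact: ItI1.
Qed.

End Karhunen_Loeve.

(** * Expectations computed from the density of a random vector *)

Section density_vector.
Local Open Scope ereal_scope.
Context d (Om : measurableType d) (R : realType) (P : probability Om R).

Lemma iint_density_vec N (X : Om -> N.-tuple R) (f : N.-tuple R -> R)
    (g : N.-tuple R -> \bar R) :
  measurable_fun setT X -> is_density_vec P X f ->
  measurable_fun setT g -> (forall v, 0 <= g v) ->
  iint (fun v => g v * (f v)%:E) = \int[P]_w g (X w).
Proof.
move=> mX [f_ge0 mf fX] mg g_ge0.
have [m mE] := @iint_integral R N.
have mfE : measurable_fun setT (fun v => (f v)%:E) by exact/measurable_EFinP.
have fXm A : measurable A -> P (X @^-1` A) = \int[m]_(v in A) (f v)%:E.
  move=> mA; rewrite fX// mE; last 2 first.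
  - apply: emeasurable_funM => //; apply/measurable_EFinP.
    exact: measurable_indic.
  - by move=> v; rewrite mule_ge0// lee_fin.
  rewrite [RHS]integral_mkcond; apply: eq_integral => v _.
  by rewrite epatch_indic.
rewrite mE; last 2 first.
- exact: emeasurable_funM.
- by move=> v; rewrite mule_ge0// lee_fin.
by rewrite (ge0_integral_density mX f_ge0 mf fXm).
Qed.

End density_vector.

(** * Existence of the density of [x(t)] and convergence of [f1N] to it *)

Unset Implicit Arguments.

Theorem theorem10 (R : realType) (d : measure_display) (Om : measurableType d)
  (P : probability Om R)
  (* complete probability space *)
  (P_complete : measure_is_complete P)
  (t0 T : R) (t0_lt_T : t0 < T)
  (* x0 a random variable, a a stochastic process on [t0,T] *)
  (x0 : Om -> R) (x0_meas : measurable_fun [set: Om] x0)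
  (a : R -> Om -> R)
  (* (H1) a in L^2([t0,T] x Omega) *)
  (H1_meas : measurable_fun (`[t0, T] `*` [set: Om]) (fun p => a p.1 p.2))
  (H1_L2 : (\int[(@lebesgue_measure R) \x P]_(p in `[t0, T] `*` [set: Om])
              ((a p.1 p.2) ^+ 2)%:E < +oo)%E)
  (* Karhunen-Loeve data (indexed from 1): nu_j, phi_j, xi_j *)
  (nu : nat -> R) (phi : nat -> R -> R) (xi : nat -> Om -> R)
  (nu_ge0 : forall j, 0 <= nu j.+1) (nu1_gt0 : 0 < nu 1)
  (phi_meas : forall j, measurable_fun `[t0, T] (phi j.+1))
  (phi_orthonormal : forall i j,
     intI t0 T (fun s => phi i.+1 s * phi j.+1 s) = (i == j)%:R)
  (phi_basis : forall f : R -> R, measurable_fun `[t0, T] f ->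
     (\int[@lebesgue_measure R]_(s in `[t0, T]) ((f s) ^+ 2)%:E < +oo)%E ->
     (fun n : nat => \int[@lebesgue_measure R]_(s in `[t0, T])
        ((f s - \sum_(j < n) intI t0 T (fun u => f u * phi j.+1 u) * phi j.+1 s)
           ^+ 2)%:E)%E @ \oo --> 0%E)
  (phi_eigen : forall j, {ae @lebesgue_measure R, forall t, t \in `[t0, T] ->
     intI t0 T (fun s => cov_fun P a t s * phi j.+1 s) = nu j.+1 * phi j.+1 t})
  (xi_meas : forall j, measurable_fun [set: Om] (xi j.+1))
  (xi_mean0 : forall j, (\int[P]_w (xi j.+1 w)%:E = 0)%E)
  (xi_uncorr : forall i j,
     (\int[P]_w (xi i.+1 w * xi j.+1 w)%:E = ((i == j)%:R)%:E)%E)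
  (KL_conv : (fun N : nat =>
     \int[(@lebesgue_measure R) \x P]_(p in `[t0, T] `*` [set: Om])
       ((a p.1 p.2 - mean_fun P a p.1
         - \sum_(j < N) Num.sqrt (nu j.+1) * phi j.+1 p.1 * xi j.+1 p.2) ^+ 2)%:E)%E
     @ \oo --> 0%E)
  (* (H2) *)
  (H2 : forall N : nat, (2 <= N)%N ->
     [/\ abs_cont P x0, abs_cont P (xi 1), abs_cont_vec P (xi_tail xi N)
       & indep3 P x0 (xi 1) (xi_tail xi N)])
  (* (H3) *)
  (g1 : R -> R) (g1_density : is_density P (xi 1) g1)
  (g1_cont : continuous g1) (g1_bounded : exists M : R, forall y, `|g1 y| <= M)
  (* (H4) *)
  (H4 : forall t, t0 < t <= T -> intI t0 t (phi 1) != 0)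
  (* (H5) *)
  (H5 : {ae P, forall w, 0 < x0 w} \/ {ae P, forall w, x0 w < 0})
  (* densities f_0 of x0 and f_{xi_N} of xi_N *)
  (f0 : R -> R) (f0_density : is_density P x0 f0)
  (fxi : forall N : nat, N.-tuple R -> R)
  (fxi_density : forall N : nat, (0 < N)%N -> is_density_vec P (xi_vec xi N) (fxi N)) :
  forall t : R, t0 < t <= T ->
  exists f1 : R -> R,
    is_density P (fun w => x0 w * expR (intI t0 t (fun s => a s w))) f1 /\
    forall x : R, x != 0 ->
      (fun N : nat => f1N f0 (mean_fun P a) nu phi t0 fxi N x t) @ \oo
        --> (f1 x)%:E.
Proof.
move=> t /andP[t0t tT].
have phi_norm j : intI t0 T (fun s => phi j.+1 s * phi j.+1 s) = 1.
  by rewrite phi_orthonormal eqxx.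
have [M g1M] := g1_bounded.
pose m := intI t0 t (mean_fun P a).
pose coef := KL_coef t0 t nu phi.
pose c := coef 0%N.
have c0 : c != 0.
  by rewrite mulf_neq0 ?H4 ?t0t// sqrtr_eq0 -ltNge.
pose K := path_integral t0 t a.
pose K_ := KL_partial P t0 t a nu phi xi.
have mK : measurable_fun setT K by exact: (measurable_path_integral tT H1_meas H1_L2).
have mK_ N : measurable_fun setT (K_ N) by exact: measurable_KL_partial.
have K_K : (\int[P]_w `|K_ N.+1 w - K w|%:E)%E @[N --> \oo] --> 0%E.
  have := cvg_KL_partial tT H1_meas H1_L2 phi_meas phi_norm xi_meas KL_conv.
  by rewrite -cvg_shiftS.
(* [S_ N] has [N] terms, in [xi 2] up to [xi N.+1], and therefore goes with [K_ N.+1]; all sequences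
   below are shifted by one accordingly. *)
pose S_ N w := \sum_(i < N) coef i.+1 * xi i.+2 w.
pose S w := K w - m - c * xi 1 w.
have K_E N w : K_ N.+1 w = m + c * xi 1 w + S_ N w.
  by rewrite /K_ /KL_partial big_ord_recl/= addrA.
have KE : K = (fun w => m + c * xi 1 w + S w).
  by apply/funext => w; rewrite /S; ring.
have mS_ N : measurable_fun setT (S_ N).
  by apply: measurable_sum => i; exact: measurable_funM.
have mS : measurable_fun setT S.
  apply: measurable_funB; first exact: measurable_funB.
  by apply: measurable_funM => //; exact: (xi_meas 0%N).
have S_S : (\int[P]_w `|S_ N w - S w|%:E)%E @[N --> \oo] --> 0%E.
  rewrite (_ : (fun N => _) = (fun N => \int[P]_w `|K_ N.+1 w - K w|%:E)%E)//.
  apply/funext => N; apply: eq_integral => w _; congr (`|_|%:E).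
  by rewrite K_E /S; ring.
have mtail N : measurable_fun setT (xi_tail xi N).
  apply/measurable_fun_tnthP => i; rewrite (_ : _ \o _ = xi i.+2)//.
  by apply/funext => w /=; rewrite tnth_mktuple.
pose F N (v : N.-tuple R) := \sum_(i < N) coef i.+1 * tnth v i.
have mF N : measurable_fun setT (@F N).
  apply: measurable_sum => i; apply: measurable_funM => //.
  exact: measurable_tnth.
have S_E N : S_ N = @F N \o xi_tail xi N.+1.
  by apply/funext => w /=; apply: eq_bigr => i _; rewrite tnth_mktuple.
(* [H2] is applied at [N.+1], which must be at least 2, so independence is obtained from [N = 1] on.
   The event for [x0] is taken to be the whole space. *)
have xi1_S_ : \forall N \near \oo, indep2 P (xi 1) (S_ N).
  exists 1%N => // N /= N1; have [_ _ _ ind] := H2 N.+1 N1.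
  rewrite S_E; apply: (indep2_comp (mF N)) => A B mA mB.
  have := ind setT A B measurableT mA mB.
  by rewrite preimage_setT setTI probability_setT mul1e.
have x0_K_ : \forall N \near \oo, indep2 P x0 (K_ N.+1).
  exists 1%N => // N /= N1; have [_ _ _ ind] := H2 N.+1 N1.
  have ind2 := indep2_joint x0_meas (xi_meas 0%N) (mtail N.+1) ind.
  pose G (z : R * N.-tuple R) := m + c * z.1 + F N z.2.
  have mG : measurable_fun setT G.
    apply: measurable_funD; first by apply: measurable_funD => //; exact: measurable_funM.
    exact: (measurableT_comp (mF N)).
  rewrite (_ : K_ N.+1 = G \o (fun w => (xi 1 w, xi_tail xi N.+1 w))).
    exact: (indep2_comp mG).
  by apply/funext => w; rewrite K_E S_E.
have xi1_S : indep2 P (xi 1) S.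
  exact: (indep2_limit (xi_meas 0%N) mS_ mS xi1_S_ S_S).
have x0_K : indep2 P x0 K.
  exact: (indep2_limit x0_meas (fun N => mK_ N.+1) mK x0_K_ K_K).
pose k_ N := sum_density P g1 m c (S_ N).
pose k := sum_density P g1 m c S.
have dK : is_density P K k.
  by rewrite KE; exact: (is_density_sum m g1M c0 g1_density (xi_meas 0%N) mS xi1_S).
have dK_ : \forall N \near \oo, is_density P (K_ N.+1) (k_ N).
  apply: filterS xi1_S_ => N indN.
  rewrite (_ : K_ N.+1 = fun w => m + c * xi 1 w + S_ N w); last exact/funext.
  exact: (is_density_sum m g1M c0 g1_density (xi_meas 0%N) (mS_ N) indN).
(* For fixed [u] the density is the expectation of a bounded continuous function of [S_ N], so
   convergence in mean of [S_] suffices. *)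
have k_k u : k_ ^~ u @ \oo --> k u.
  have ch : continuous (fun s => `|c|^-1 * g1 ((u - m - s) / c)).
    move=> s; apply: cvgM; first exact: cvg_cst.
    apply: (@continuous_comp _ _ _ (fun s => (u - m - s) / c) g1).
      by apply: cvgM; [apply: cvgB; [exact: cvg_cst|exact: cvg_id]|exact: cvg_cst].
    exact: g1_cont.
  have hB s : `| `|c|^-1 * g1 ((u - m - s) / c)| <= `|c|^-1 * M.
    by rewrite normrM ger0_norm ?invr_ge0// ler_wpM2l ?invr_ge0.
  have := cvg_integral_bounded_continuous mS_ mS S_S measurableT ch hB.
  rewrite -(sum_densityE m c g1M g1_density mS).
  under eq_cvg do rewrite -(sum_densityE m c g1M g1_density (mS_ _)).
  exact: fine_cvg.
have [f0_ge0 mf0 f0E] := f0_density.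
have f0_lty : (\int[lebesgue_measure]_x (f0 x)%:E < +oo)%E.
  by rewrite -f0E// preimage_setT probability_setT ltry.
have mk_ N : measurable_fun setT (k_ N).
  exact: (measurable_sum_density m c g1M g1_density (mS_ N)).
have mk : measurable_fun setT k.
  exact: (measurable_sum_density m c g1M g1_density mS).
have k_B N u : 0 <= k_ N u <= `|c|^-1 * M.
  apply/andP; split.
    exact: (sum_density_ge0 m c g1M g1_density (mS_ N)).
  exact: (sum_density_le m c g1M g1_density (mS_ N)).
have mix x : x != 0 ->
    exp_mixture f0 (k_ N) x @[N --> \oo] --> exp_mixture f0 k x /\
    exp_mixture f0 k x \is a fin_num.
  by move=> x0n; exact: (cvg_exp_mixture f0_ge0 mf0 f0_lty x0n mk_ mk k_B k_k).
exists (fun x => fine (exp_mixture f0 k x)); split.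
  apply: (is_density_mul_expR x0_meas mK f0_density dK x0_K) => x xn.
  by have [] := mix x xn.
move=> x xn; have [mix_cvg mix_fin] := mix x xn.
rewrite fineK// -cvg_shiftS; apply: cvg_trans mix_cvg.
apply: near_eq_cvg; apply: filterS dK_ => N dKN /=.
have vecE w : K_a (mean_fun P a) nu phi t0 t (xi_vec xi N.+1 w) = K_ N.+1 w.
  rewrite (K_aE tT H1_meas H1_L2 nu phi_meas phi_norm) /K_ /KL_partial; congr (_ + _).
  by apply: eq_bigr => i _; rewrite tnth_mktuple.
have mvec : measurable_fun setT (xi_vec xi N.+1).
  apply/measurable_fun_tnthP => i; rewrite (_ : _ \o _ = xi i.+1)//.
  by apply/funext => w /=; rewrite tnth_mktuple.
have mKa : measurable_fun setT
    (fun v : N.+1.-tuple R => K_a (mean_fun P a) nu phi t0 t v).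
  rewrite (_ : (fun v => _) = fun v => m + \sum_(i < N.+1) coef i * tnth v i).
    apply: measurable_funD => //; apply: measurable_sum => i.
    by apply: measurable_funM => //; exact: measurable_tnth.
  by apply/funext => v; rewrite (K_aE tT H1_meas H1_L2 nu phi_meas phi_norm).
have mker := measurable_exp_kernel mf0 x.
(* The mixture and [f1N] are the same expectation: the mixture computes it from the density [k_ N]
   of [K_ N.+1], and [f1N] from the joint density [fxi N.+1]. *)
transitivity (\int[P]_w (exp_kernel f0 x (K_ N.+1 w))%:E)%E.
  rewrite (ge0_integral_is_density (mK_ N.+1) dKN (h := fun u => (exp_kernel f0 x u)%:E)).
  - by apply: eq_integral => u _; rewrite EFinM.
  - exact/measurable_EFinP.
  - by move=> u; rewrite lee_fin exp_kernel_ge0.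
pose q (v : N.+1.-tuple R) := (exp_kernel f0 x (K_a (mean_fun P a) nu phi t0 t v))%:E.
have mq : measurable_fun setT q.
  by apply/measurable_EFinP; exact: (measurableT_comp mker mKa).
have q_ge0 v : (0 <= q v)%E by rewrite lee_fin exp_kernel_ge0.
transitivity (iint (fun v => q v * (fxi N.+1 v)%:E)%E).
  rewrite (iint_density_vec mvec (fxi_density N.+1 isT) mq q_ge0).
  by apply: eq_integral => w _; rewrite /q vecE.
rewrite /f1N; congr iint; apply/funext => v.
by rewrite /q -EFinM /exp_kernel mulrAC.
Qed.
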